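(* Let $F$ be an odd function with $F'(0)>1$, let $\zeta>0$, and define $$\underline c_*:=\zeta\,\Sigma(\Upsilon_F,\gamma)\qquad\text{and}\qquad \overline c_*:=\zeta\,\Sigma(F'(0),\gamma).$$ (1) If $\Sigma(\Upsilon_F,\gamma)>0$, then there is a $\overline v\in C([0,\infty))$ such that $\overline v(0)=0$ and $$u(t,x)\le\overline v(xe^{-\underline c_*t})\qquad\text{for all }t\ge1\text{ and }x\ge0.$$ (2) If $\nu\ge0$ and $\nu>\zeta\,\Sigma(F'(0),\gamma)$, then there is a $\underline v\in C([0,\infty))$ such that $\lim_{x\to\infty}\underline v(x)=\Xi_F$ and $$u(t,x)\ge\underline v(xe^{-\nu t})\qquad\text{for all }t,x\ge0.$$
   Context: Fix $\gamma>1$, $\zeta>0$, offspring probabilities $p_n\ge 0$ ($n\ge1$) with $\sum_{n\ge1}p_n=1$, and threshold probabilities $\eta_{n,k}\ge0$ ($n\ge1$, $1\le k\le n$) with $\sum_{k=1}^n\eta_{n,k}=1$ for each $n$. Define $F:[-1,1]\to[-1,1]$ by $$F(u)=\sum_{n\ge1}2^{1-n}p_n\sum_{k=1}^n\eta_{n,k}\sum_{j=k}^n\binom nj(1+u)^j(1-u)^{n-j}-1 ,$$ so $F(\pm1)=\pm1$. The function $F$ is increasing and is taken to be $C^2$ on $[0,1]$. Put $\Upsilon_F:=\sup_{v\in(0,1]}F(v)/v$, $\Xi_F:=\inf\{v>0:F(v)\le v\}$, and for $f,\gamma>1$ $$\Sigma(f,\gamma):=\sup_{\omega\in(0,1]}\frac{1-f\gamma^{-\omega}}{\omega}.$$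 The function $u:[0,\infty)\times\mathbb{R}\to[-1,1]$ is the solution (in the Duhamel/mild sense) of $$\partial_tu(t,x)=\tfrac12\Delta u(t,x)+\zeta\bigl[F(u(t,\gamma^{-1}x))-u(t,x)\bigr]\ (t>0,\ x\in\mathbb{R}),\qquad u(0,x)=\operatorname{sgn}(x)\quad(\operatorname{sgn}(0)=0),$$ i.e. $u(t,\cdot)=e^{t(\frac12\Delta-\zeta)}\operatorname{sgn}+\zeta\int_0^te^{(t-s)(\frac12\Delta-\zeta)}\bigl[F(u(s,\gamma^{-1}\cdot))\bigr]\,ds$. (Probabilistic meaning: $u(t,x)=2p-1$, where $p$ is the probability that the initial particle, started at $x$ in generation $0$, votes $1$ in the random-threshold voting model on a branching Brownian motion in which generation-$k$ particles have generator $\frac12\gamma^{2k}\Delta$, branch at rate $\zeta$ into $n$ children with probability $p_n$, and particles alive at time $t$ vote the sign of their position; a parent of $n$ children votes $1$ iff at least $L$ of its children vote $1$, where $P(L=k)=\eta_{n,k}$.) *)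

(* Defs.v *)
From HB Require Import structures.
From mathcomp Require Import all_boot all_order all_algebra.
From mathcomp Require Import all_classical all_reals all_analysis.
Set Implicit Arguments.
Unset Strict Implicit.
Unset Printing Implicit Defensive.
Import Order.TTheory GRing.Theory Num.Theory.
Import numFieldNormedType.Exports.
Local Open Scope classical_set_scope.
Local Open Scope ring_scope.

(* Families are indexed by all of nat, but only the indices n >= 1 (and
   1 <= k <= n) are ever used. *)
Definition is_offspring_law (R : realType) (p : nat -> R) : Prop :=
  (forall n, (1 <= n)%N -> 0 <= p n) /\
  \sum_(1 <= n < N) p n @[N --> \oo] --> (1 : R).

Definition is_threshold_law (R : realType) (eta : nat -> nat -> R) : Prop :=
  (forall n k, (1 <= k <= n)%N -> 0 <= eta n k) /\
  (forall n, (1 <= n)%N -> \sum_(1 <= k < n.+1) eta n k = 1).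

(* Meaningful for v in [-1, 1], where the series converges (its n-th term
   lies in [0, 2 * p n]). *)
Definition voting_fun (R : realType) (p : nat -> R) (eta : nat -> nat -> R)
    (v : R) : R :=
  \big[+%R/0]_(1 <= n <oo)
     (2 ^- n.-1 * p n *
        \sum_(1 <= k < n.+1) eta n k *
          \sum_(k <= j < n.+1) 'C(n, j)%:R * (1 + v) ^+ j * (1 - v) ^+ (n - j))
  - 1.

Definition odd_on_unit (R : realType) (F : R -> R) : Prop :=
  forall v, v \in `[-1, 1] -> F (- v) = - F v.

(* One-sided at the end points of an interval A. *)
Definition is_derive_within (R : realType) (A : set R) (f : R -> R) (x l : R)
    : Prop :=
  (f y - f x) / (y - x) @[y --> within A (x^')] --> l.

Definition C2_on (R : realType) (A : set R) (f : R -> R) : Prop :=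
  exists f1 f2 : R -> R,
    [/\ forall x, A x -> is_derive_within A f x (f1 x),
        forall x, A x -> is_derive_within A f1 x (f2 x)
      & {within A, continuous f2}].

Definition Upsilon (R : realType) (F : R -> R) : R :=
  sup [set F v / v | v in `]0, 1]].

(* F lives on [-1, 1], so the condition v > 0 means 0 < v <= 1. *)
Definition Xi (R : realType) (F : R -> R) : R :=
  inf [set v | v \in `]0, 1] /\ F v <= v].

Definition Sigma (R : realType) (f gamma : R) : R :=
  sup [set (1 - f * gamma `^ (- w)) / w | w in `]0, 1]].

(* exp(t Delta / 2): convolution with the centred Gaussian of variance t. The
   case t = 0 is separate because normal_pdf with zero deviation is not a
   Dirac mass. *)
Definition heat (R : realType) (t : R) (g : R -> R) (x : R) : R :=
  if t == 0 then g x
  else (\int[lebesgue_measure]_y (normal_pdf x (Num.sqrt t) y * g y))%R.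

(* exp(t (Delta / 2 - zeta)) *)
Definition killed_heat (R : realType) (zeta t : R) (g : R -> R) (x : R) : R :=
  expR (- (zeta * t)) * heat t g x.

(* Only the values u t x with t >= 0 are constrained. *)
Definition mild_solution (R : realType) (gamma zeta : R) (F : R -> R)
    (u : R -> R -> R) : Prop :=
  [/\ forall t x, 0 <= t -> -1 <= u t x <= 1,
      measurable_fun [set z : measurableTypeR R * measurableTypeR R | 0 <= z.1]
        (fun z => u z.1 z.2 : measurableTypeR R)
    & forall t x, 0 <= t ->
        u t x =
          killed_heat zeta t (@Num.sg R) x +
          zeta * (\int[lebesgue_measure]_(s in `[0, t])
                    killed_heat zeta (t - s)
                      (fun y => F (u s (gamma^-1 * y))) x)%R].

(* Main.v *)
Require Import Defs.
From HB Require Import structures.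
From mathcomp Require Import all_boot all_order all_algebra.
From mathcomp Require Import ring lra.
From mathcomp Require Import all_classical all_reals all_analysis.
From mathcomp Require Import measurable_realfun probability normal_distribution.
Import Order.TTheory GRing.Theory Num.Theory.
Import numFieldNormedType.Exports.
Local Open Scope classical_set_scope.
Local Open Scope ring_scope.
Set Implicit Arguments.
Unset Strict Implicit.
Unset Printing Implicit Defensive.

(** The mild equation satisfies a comparison principle on the half line: an
    iterated Gronwall estimate, using that the heat flow of an odd function which
    is nonnegative on [x >= 0] stays so. Both parts compare [u] with explicit
    odd barriers.

    (1) As [F v <= Upsilon v] for [v >= 0], [u] lies below a supersolution of the
    equation with nonlinearity [min (1, Upsilon v)]. Concavity of [x ^ w] for
    [0 < w <= 1] shows that [exp ((kappa - zeta) t) x ^ w] with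
    [kappa = zeta Upsilon gamma ^ (- w)] is one, up to a correction for the initial
    jump at the origin; taking [w] optimal in [Sigma] gives [(zeta - kappa) / w]
    as the speed.

    (2) A function of [x exp (- nu t)] whose logarithmic slope decreases slowly from
    [1] to [0] is a subsolution: locally it is a power [x ^ w], for which
    [zeta - nu w < zeta f gamma ^ (- w)] with [f < F'(0)] by the choice of [nu]. So [u]
    is bounded below by a positive constant on [x >= K exp (nu t)]. Iterating [F]
    in the mild equation improves the constant to a fixed point of [F], which is
    at least [Xi]. *)

(** The half line is forced: [F v <= Upsilon v] and the concavity of [x ^ w] hold only for
    nonnegative arguments, and oddness is what lets the heat flow be restricted there. No derivative
    in space is ever taken: symmetric second differences of the barriers are bounded by quadratics
    and integrated against a crude second moment bound for the Gaussian.

    In (1) the obstacle is the jump of the initial datum: at time 0 no multiple of [x ^ w] dominates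
    it near the origin, so the coefficient of the barrier blows up like [t ^ (-1/2)], which is
    integrable. In (2) the Duhamel formula loses a factor three times, through diffusion, through
    the variation of the slope and through cutting the time integral to a bounded window; the strict
    inequality on [nu] yields a gain that pays for all three. Since slopes reach 0, outside the
    range of the supremum in [Sigma], the margin near [w = 0] comes from [F'(0) > 1] instead. *)

Section heat.
Context {R : realType}.
Notation mu := (@lebesgue_measure R).
Implicit Types (g h : R -> R) (t x : R).

(** * The heat semigroup on bounded measurable functions *)

Definition bounded_measurable g : Prop :=
  measurable_fun [set: measurableTypeR R] g /\ exists M, forall y, `|g y| <= M.

Lemma bmf_cst (c : R) : bounded_measurable (fun=> c).
Proof. by split; [exact: measurable_cst|exists `|c|]. Qed.

Lemma bmfD g h : bounded_measurable g -> bounded_measurable h ->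
  bounded_measurable (fun y => g y + h y).
Proof.
move=> [mg [M gM]] [mh [N hN]]; split; first exact: measurable_funD.
by exists (M + N) => y; rewrite (le_trans (ler_normD _ _))// lerD.
Qed.

Lemma bmfZ (c : R) g : bounded_measurable g -> bounded_measurable (fun y => c * g y).
Proof.
move=> [mg [M gM]]; split; first exact: measurable_funM.
by exists (`|c| * M) => y; rewrite normrM ler_wpM2l.
Qed.

Lemma bmfN g : bounded_measurable g -> bounded_measurable (fun y => - g y).
Proof.
move=> /(@bmfZ (-1)); congr bounded_measurable.
by apply/funext => y; rewrite mulN1r.
Qed.

Lemma bmf_comp g (phi : R -> R) : measurable_fun [set: measurableTypeR R] (phi : _ -> measurableTypeR R) ->
  bounded_measurable g -> bounded_measurable (fun y => g (phi y)).
Proof.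
move=> mphi [mg [M gM]]; split; last by exists M.
exact: measurableT_comp mg mphi.
Qed.

Lemma bmf_refl g (c : R) : bounded_measurable g -> bounded_measurable (fun y => g (c - y)).
Proof. by apply: bmf_comp; apply: measurable_funB. Qed.

Lemma bmf_scale g (c : R) : bounded_measurable g -> bounded_measurable (fun y => g (c * y)).
Proof. by apply: bmf_comp; apply: measurable_funM. Qed.

Lemma bmf_sg : bounded_measurable (@Num.sg R).
Proof.
split.
  have -> : (@Num.sg R) = (fun y => \1_`]0, +oo[ y - \1_`]-oo, 0[ y).
    apply/funext => y; rewrite !indicE.
    have [y0|y0|->] := ltrgtP y 0.
    - rewrite ltr0_sg// memNset ?mem_set//= ?in_itv/= ?y0// ?sub0r//.
      by rewrite andbT; apply/negP; rewrite -leNgt ltW.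
    - rewrite gtr0_sg// mem_set ?memNset//= ?in_itv/= ?y0// ?subr0//.
      by apply/negP; rewrite -leNgt ltW.
    - by rewrite sgr0 !memNset//= ?in_itv/= ?ltxx// subr0.
  by apply: measurable_funB; apply: measurable_indic.
by exists 1 => y; rewrite normr_sg; case: (y == 0).
Qed.

(** A reflection preserves Lebesgue measure; by uniqueness of the measure this needs checking on
    intervals only. *)
Lemma integral_refl (f : R -> \bar R) (c : R) :
  mu.-integrable setT f ->
  (\int[mu]_y f (c - y)%R = \int[mu]_y f y)%E.
Proof.
move=> intf.
pose phi : measurableTypeR R -> measurableTypeR R := fun y => c - y.
have mphi : measurable_fun setT phi by exact: measurable_funB.
have E A : measurable A -> pushforward mu phi A = mu A.
  move=> mA; apply/esym; apply: (@lebesgue_measure_unique R (pushforward mu phi)) => //= _ [[a b]] _ <-.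
  rewrite /pushforward (_ : phi @^-1` _ = `[c - b, c - a[%classic); last first.
    apply/seteqP; split => y /=; rewrite !in_itv/= /phi;
      by move=> /andP[h1 h2]; apply/andP; split; lra.
  rewrite !lebesgue_measure_itv/= !lte_fin ltrD2l ltrN2.
  by case: ifP => // _; rewrite -!EFinB; congr (_%:E); ring.
transitivity (\int[pushforward mu phi]_y f y)%E; last first.
  by apply: eq_measure_integral => A mA _; exact: E.
rewrite (@integral_pushforward _ _ _ _ R phi mphi mu setT f)//.
- exact: (measurable_int mu).
- have /integrableP[mf] := intf => h; apply/integrableP; split.
    exact: measurableT_comp.
  apply: le_lt_trans h.
  have := @ge0_integral_pushforward _ _ _ _ R phi mphi mu setT (abse \o f).
  rewrite preimage_setT => <-//.
  + by rewrite le_eqVlt; apply/orP; left; apply/eqP; apply: eq_measure_integral => A mA _; exact: E.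
  + exact: measurableT_comp.
  + by move=> y _; exact: abse_ge0.
Qed.

Lemma itv_bounded_integrable (a b M : R) (f : R -> R) :
  measurable_fun `[a, b]%classic (f : measurableTypeR R -> R) ->
  (forall y, a <= y <= b -> `|f y| <= M) ->
  mu.-integrable `[a, b] (EFin \o f).
Proof.
move=> mf fM; apply: measurable_bounded_integrable => //.
  by rewrite /= lebesgue_measure_itv/=; case: ifP => _; rewrite ?lte_fin ltry.
exists M; split; first by rewrite num_real.
move=> N MN y /=; rewrite in_itv/= => yab.
by apply: (le_trans (fM _ yab)); exact: ltW.
Qed.

Notation gauss t x := (normal_pdf x (Num.sqrt t)).

Lemma gaussE t x y : 0 < t ->
  gauss t x y = (Num.sqrt (t * pi *+ 2))^-1 * expR (- (y - x) ^+ 2 / (t *+ 2)).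
Proof.
move=> t0; rewrite normal_pdfE ?gt_eqF ?sqrtr_gt0//.
by rewrite /normal_peak /normal_fun sqr_sqrtr ?ltW.
Qed.

Lemma gauss_refl t x c y : 0 < t -> gauss t x (c - y) = gauss t (c - x) y.
Proof.
move=> t0; rewrite !gaussE//.
by have -> : (c - y - x) ^+ 2 = (y - (c - x)) ^+ 2 by ring.
Qed.

Lemma integrable_gaussM t x g : bounded_measurable g ->
  mu.-integrable setT (EFin \o (fun y => gauss t x y * g y)).
Proof.
move=> [mg [M gM]].
have := @integrableMl _ _ R mu setT measurableT (fun y => (gauss t x y)%:E) g.
rewrite (_ : ((fun y => (gauss t x y)%:E) \* (EFin \o g))%E = EFin \o (fun y => gauss t x y * g y)); last first.
  by apply/funext => y /=; rewrite EFinM.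
apply; [exact: integrable_normal_pdf|exact: mg|].
exists M; split; first by rewrite num_real.
by move=> N MN y _ /=; apply: (le_trans (gM y)); exact: ltW.
Qed.

Lemma heat0 g x : heat 0 g x = g x.
Proof. by rewrite /heat eqxx. Qed.

Lemma heatE t g x : 0 < t -> heat t g x = \int[mu]_y (gauss t x y * g y).
Proof. by move=> t0; rewrite /heat gt_eqF. Qed.

Lemma le_heat t g h x : 0 <= t -> bounded_measurable g -> bounded_measurable h ->
  (forall y, g y <= h y) -> heat t g x <= heat t h x.
Proof.
rewrite le_eqVlt => /predU1P[<-|t0] bg bh gh; first by rewrite !heat0.
rewrite !heatE//; apply: le_Rintegral => //; try exact: integrable_gaussM.
by move=> y _; rewrite ler_wpM2l// normal_pdf_ge0.
Qed.

Lemma heatD t g h x : 0 <= t -> bounded_measurable g -> bounded_measurable h ->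
  heat t (fun y => g y + h y) x = heat t g x + heat t h x.
Proof.
rewrite le_eqVlt => /predU1P[<-|t0] bg bh; first by rewrite !heat0.
rewrite !heatE// -RintegralD//; try exact: integrable_gaussM.
by apply: eq_Rintegral => y _; rewrite mulrDr.
Qed.

Lemma heatZ t (c : R) g x : 0 <= t -> bounded_measurable g ->
  heat t (fun y => c * g y) x = c * heat t g x.
Proof.
rewrite le_eqVlt => /predU1P[<-|t0] bg; first by rewrite !heat0.
rewrite !heatE// -RintegralZl//; try exact: integrable_gaussM.
by apply: eq_Rintegral => y _; rewrite mulrCA.
Qed.

Lemma heatN t g x : 0 <= t -> bounded_measurable g ->
  heat t (fun y => - g y) x = - heat t g x.
Proof.
move=> t0 bg; rewrite -mulN1r -heatZ//; congr heat.
by apply/funext => y; rewrite mulN1r.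
Qed.

Lemma heat_cst t (c : R) x : 0 <= t -> heat t (fun=> c) x = c.
Proof.
rewrite le_eqVlt => /predU1P[<-|t0]; first by rewrite heat0.
rewrite heatE// RintegralZr//; last exact: integrable_normal_pdf.
by rewrite /Rintegral integral_normal_pdf mul1r.
Qed.

Lemma heat_refl t (c : R) g x : 0 <= t -> bounded_measurable g ->
  heat t (fun y => g (c - y)) (c - x) = heat t g x.
Proof.
rewrite le_eqVlt => /predU1P[<-|t0] bg; first by rewrite !heat0 subKr.
rewrite !heatE// /Rintegral -(@integral_refl (fun y => (gauss t x y * g y)%:E) c).
  by congr fine; apply: eq_integral => y _; rewrite gauss_refl.
exact: integrable_gaussM.
Qed.

Lemma heat_odd t g x : 0 <= t -> bounded_measurable g ->
  (forall y, g (- y) = - g y) -> heat t g (- x) = - heat t g x.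
Proof.
move=> t0 bg og; rewrite -(heat_refl 0 (- x) t0 bg) sub0r opprK -heatN//.
by congr heat; apply/funext => y; rewrite sub0r og.
Qed.

(* Averaging the reflections [y] and [-y] gives the integrand
   [(p(x - y) - p(x + y)) g y / 2], whose two factors have the sign of [y]. *)
Lemma heat_odd_ge0 t g x : 0 <= t -> 0 <= x -> bounded_measurable g ->
  (forall y, g (- y) = - g y) -> (forall y, 0 <= y -> 0 <= g y) ->
  0 <= heat t g x.
Proof.
rewrite le_eqVlt => /predU1P[<-|t0] x0 bg og g0; first by rewrite heat0 g0.
have E : heat t g x + heat t g x =
    \int[mu]_y ((gauss t x y - gauss t (- x) y) * g y).
  rewrite -[X in X + _ = _]opprK -heat_odd ?ltW// !heatE// addrC -RintegralB//;
    try exact: integrable_gaussM.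
  by apply: eq_Rintegral => y _; rewrite mulrBl.
suff : 0 <= heat t g x + heat t g x by move=> ?; lra.
rewrite E; apply: Rintegral_ge0 => y _.
have gle (a b : R) : a ^+ 2 <= b ^+ 2 ->
    (Num.sqrt (t * pi *+ 2))^-1 * expR (- b ^+ 2 / (t *+ 2)) <=
    (Num.sqrt (t * pi *+ 2))^-1 * expR (- a ^+ 2 / (t *+ 2)).
  move=> ab; rewrite ler_wpM2l ?invr_ge0 ?sqrtr_ge0// ler_expR ler_wpM2r//.
    by rewrite invr_ge0 mulrn_wge0// ltW.
  by rewrite lerN2.
rewrite !gaussE//; have [y0|y0] := leP 0 y.
  by rewrite mulr_ge0 ?g0// subr_ge0 gle//; nra.
rewrite -[g y]opprK -og mulrN -mulNr opprB mulr_ge0 ?g0 ?oppr_ge0 ?(ltW y0)//.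
by rewrite subr_ge0 gle//; nra.
Qed.

Lemma heat_refl_center t g x : 0 <= t -> bounded_measurable g ->
  heat t (fun y => g (2 * x - y)) x = heat t g x.
Proof.
move=> t0 bg; rewrite -(heat_refl (2 * x) x t0 bg).
by have -> : 2 * x - x = x by ring.
Qed.

(** The exponential of variance [t] is the square of the one of variance [2 t]. One factor absorbs
    [(y - x) ^ 2] at the cost [4 t], by [1 + a <= exp a]; the change of normalization costs
    [sqrt 2 <= 3 / 2], whence the 6. *)
Lemma gauss_sqr_le t x y : 0 < t ->
  gauss t x y * (y - x) ^+ 2 <= 6 * t * gauss (2 * t) x y.
Proof.
move=> t0; rewrite !gaussE ?mulr_gt0//.
set z := (y - x) ^+ 2; have z0 : 0 <= z by exact: sqr_ge0.
set e := expR (- z / (2 * t *+ 2)).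
have -> : expR (- z / (t *+ 2)) = e * e.
  by rewrite -expRD; congr expR; field; rewrite gt_eqF.
have ez : e * z <= 4 * t.
  have := expR_ge1Dx (z / (4 * t)).
  have -> : expR (z / (4 * t)) = e^-1.
    by rewrite /e -expRN; congr expR; field; rewrite gt_eqF.
  move=> h; have : z / (4 * t) <= e^-1 by lra.
  by rewrite ler_pdivrMr ?mulr_gt0// ler_pdivlMl ?expR_gt0.
have -> : Num.sqrt (2 * t * pi *+ 2) = Num.sqrt 2 * Num.sqrt (t * pi *+ 2) :> R.
  by rewrite -sqrtrM ?mulr_ge0//; congr Num.sqrt; ring.
set q := (Num.sqrt (t * pi *+ 2))^-1.
have q0 : 0 <= q by rewrite invr_ge0 sqrtr_ge0.
have s2 : 0 < Num.sqrt 2 :> R by rewrite sqrtr_gt0.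
have s22 : Num.sqrt 2 <= 3 / 2 :> R.
  rewrite -[leRHS]ger0_norm// -sqrtr_sqr ler_wsqrtr//; lra.
have -> : 6 * t * ((Num.sqrt 2 * Num.sqrt (t * pi *+ 2))^-1 * e) =
   q * e * (6 * t / Num.sqrt 2) by rewrite invfM -/q; ring.
have -> : q * (e * e) * z = q * e * (e * z) by ring.
rewrite ler_wpM2l ?mulr_ge0 ?expR_ge0// (le_trans ez)// ler_pdivlMr//; nra.
Qed.

(** Averaging [g] with its reflection about [x] leaves the heat flow at [x] unchanged, so only the
    symmetric sum has to be bounded and first-order terms cancel. *)
Lemma le_heat_quadratic t g (A B : R) x : 0 <= t -> 0 <= B -> bounded_measurable g ->
  (forall z, g (x + z) + g (x - z) <= 2 * (A + B * z ^+ 2)) ->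
  heat t g x <= A + 6 * t * B.
Proof.
rewrite le_eqVlt => /predU1P[<-|t0] B0 bg gAB.
  by have := gAB 0; rewrite heat0 addr0 subr0; lra.
pose h y := 2^-1 * (g y + g (2 * x - y)) - A.
have brg : bounded_measurable (fun y => g (2 * x - y)) by exact: bmf_refl.
have bh' : bounded_measurable (fun y => 2^-1 * (g y + g (2 * x - y))).
  by apply: bmfZ; exact: bmfD.
have bh : bounded_measurable h by apply: bmfD => //; exact: bmf_cst.
have -> : heat t g x = A + heat t h x.
  rewrite heatD ?ltW//; last exact: bmf_cst.
  rewrite heat_cst ?ltW// heatZ ?heatD ?ltW//; last exact: bmfD.
  by rewrite heat_refl_center ?ltW//; field.
rewrite lerD2l heatE//.
have iG := integrable_normal_pdf x (Num.sqrt (2 * t)).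
apply: (@le_trans _ _ (\int[mu]_y (6 * t * B * gauss (2 * t) x y))).
  apply: le_Rintegral => //; first exact: integrable_gaussM.
    exact: (integrableZl _ _ iG).
  move=> y _.
  have hy : h y <= B * (y - x) ^+ 2.
    have := gAB (y - x); rewrite /h.
    have -> : x + (y - x) = y by ring.
    have -> : x - (y - x) = 2 * x - y by ring.
    lra.
  rewrite (le_trans (ler_wpM2l (normal_pdf_ge0 _ _ _) hy))//.
  by have := gauss_sqr_le x y t0; nra.
rewrite RintegralZl//.
by rewrite /Rintegral integral_normal_pdf mulr1.
Qed.

Lemma ge_heat_quadratic t g (A B : R) x : 0 <= t -> 0 <= B -> bounded_measurable g ->
  (forall z, 2 * (A - B * z ^+ 2) <= g (x + z) + g (x - z)) ->
  A - 6 * t * B <= heat t g x.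
Proof.
move=> t0 B0 bg gAB.
have := @le_heat_quadratic t (fun y => - g y) (- A) B x t0 B0 (bmfN bg).
rewrite heatN// => H; suff : - heat t g x <= - A + 6 * t * B by lra.
by apply: H => z; have := gAB z; lra.
Qed.

(** Symmetrized about [x], the sign is at most the indicator of [[0, 2 x]]. The Gaussian density is
    at most [1 / sqrt (2 pi t)], and [sqrt (2 pi) >= 2]. *)
Lemma heat_sg_le t x : 0 < t -> 0 <= x -> heat t (@Num.sg R) x <= x / Num.sqrt t.
Proof.
move=> t0 x0.
pose h := fun y : R => \1_`[0, 2 * x] y : R.
have bh : bounded_measurable h.
  split; first exact: measurable_indic.
  by exists 1 => y; rewrite /h indicE; case: (_ \in _); rewrite ?normr1 ?normr0.
have bs := bmf_sg.
have -> : heat t (@Num.sg R) x =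
    heat t (fun y => 2^-1 * (Num.sg y + Num.sg (2 * x - y))) x.
  have br : bounded_measurable (fun y : R => Num.sg (2 * x - y)) by exact: bmf_refl.
  rewrite heatZ ?heatD ?ltW//; last exact: bmfD.
  by rewrite heat_refl_center ?ltW//; field.
apply: (@le_trans _ _ (heat t h x)).
  apply: le_heat; rewrite ?ltW//.
    by apply: bmfZ; apply: bmfD => //; exact: bmf_refl.
  move=> y; rewrite /h indicE.
  have -> : (y \in `[0, 2 * x]%classic) = (0 <= y <= 2 * x) by rewrite mem_setE in_itv.
  case: (boolP (0 <= y <= 2 * x)).
    move=> _; have := ler_norm (Num.sg y); have := ler_norm (Num.sg (2 * x - y)).
    by rewrite !normr_sg; case: (_ != 0); case: (_ != 0) => /=; lra.
  rewrite negb_and -!ltNge => /orP[y0|y0].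
    by rewrite mulr0n (ltr0_sg y0) (@gtr0_sg _ (2 * x - y)) ?addNr ?mulr0//; lra.
  by rewrite mulr0n (@gtr0_sg _ y) ?(@ltr0_sg _ (2 * x - y)) ?subrr ?mulr0//; lra.
rewrite heatE//.
have mI : measurable `[0, 2 * x]%classic by [].
apply: (@le_trans _ _ (\int[mu]_(y in `[0, 2 * x]) ((Num.sqrt (t * pi *+ 2))^-1))).
  rewrite [leRHS]Rintegral_mkcond; apply: le_Rintegral => //.
  - exact: integrable_gaussM.
  - rewrite -restrict_EFin; apply/integrable_restrict => //; rewrite setTI.
    exact: itv_bounded_integrable.
  - move=> y _; rewrite patchE /h indicE; case: (boolP (y \in _)) => _; last by rewrite mulr0.
    rewrite mulr1 gaussE// ler_piMr ?invr_ge0 ?sqrtr_ge0//.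
    by rewrite -expR0 ler_expR mulNr oppr_le0 divr_ge0 ?sqr_ge0// mulrn_wge0// ltW.
rewrite Rintegral_cst// /= lebesgue_measure_itv/=.
case: ifP => [_|_]; last by rewrite mulr0 divr_ge0 ?sqrtr_ge0.
rewrite sube0 /= mulrC -[leRHS]mulrC.
have -> : Num.sqrt (t * pi *+ 2) = Num.sqrt t * Num.sqrt (pi *+ 2) :> R.
  by rewrite -sqrtrM ?ltW//; congr Num.sqrt; ring.
have sp : 2 <= Num.sqrt (pi *+ 2) :> R.
  rewrite -[leLHS]ger0_norm// -sqrtr_sqr ler_wsqrtr//.
  by have := pi_ge2 R; lra.
have st : 0 < Num.sqrt t by rewrite sqrtr_gt0.
set b := Num.sqrt (pi *+ 2) in sp *; have b0 : 0 < b by lra.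
have -> : 2 * x / (Num.sqrt t * b) = (Num.sqrt t)^-1 * x * (2 / b).
  by field; rewrite !gt_eqF.
by rewrite ler_piMr ?mulr_ge0 ?invr_ge0 ?(ltW st)// ler_pdivrMr// mul1r.
Qed.

End heat.

(** * The Duhamel integral: measurability in time and monotonicity *)

Section duhamel.
Context {R : realType}.
Notation mu := (@lebesgue_measure R).
Implicit Types (g h : R -> R -> R) (t x zeta : R).

Lemma Rintegral_FTC (f F : R -> R) (a b : R) : a <= b ->
  (forall x, a <= x <= b -> is_derive x (1 : R) F (f x)) ->
  {within `[a, b], continuous f} ->
  \int[mu]_(x in `[a, b]) f x = F b - F a.
Proof.
rewrite le_eqVlt => /predU1P[<- _ _|ab dF cf].
  by rewrite subrr set_itv1 Rintegral_set1.
have cF y : a <= y <= b -> F @ y --> F y.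
  move=> /dF[dFy _]; apply: differentiable_continuous.
  exact/derivable1_diffP.
rewrite /Rintegral (continuous_FTC2 ab cf (F := F))//.
- split.
  + by move=> y; rewrite in_itv/= => /andP[ay yb]; have [] := dF y; rewrite ?(ltW ay) ?ltW.
  + by apply: cvg_at_right_filter; apply: cF; rewrite lexx ltW.
  + by apply: cvg_at_left_filter; apply: cF; rewrite lexx ltW.
- move=> y; rewrite in_itv/= => /andP[ay yb]; rewrite derive1E.
  by have [] := dF y; rewrite ?(ltW ay) ?ltW.
Qed.

Definition jointly_bounded_measurable g : Prop :=
  measurable_fun [set: measurableTypeR R * measurableTypeR R]
    (fun z => g z.1 z.2 : R) /\
  exists M, forall s y, `|g s y| <= M.

Lemma jbm_section g s : jointly_bounded_measurable g -> bounded_measurable (g s).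
Proof.
move=> [mg [M gM]]; split; last by exists M => y; exact: gM.
exact: (measurable_fun_pair2 s mg).
Qed.

Lemma jbm_comp g (phi : R -> R) :
  measurable_fun [set: measurableTypeR R] (phi : measurableTypeR R -> measurableTypeR R) ->
  jointly_bounded_measurable g ->
  jointly_bounded_measurable (fun s y => g s (phi y)).
Proof.
move=> mphi [mg [M gM]]; split; last by exists M.
have mp : measurable_fun [set: measurableTypeR R * measurableTypeR R]
    (fun z : measurableTypeR R * measurableTypeR R => (z.1, phi z.2) : measurableTypeR R * measurableTypeR R).
  apply: measurable_fun_pair; first exact: measurable_fst.
  by apply: (measurableT_comp mphi); exact: measurable_snd.
exact: (measurableT_comp mg mp).
Qed.

(** Tonelli's theorem applies to the nonnegative function [g + M]; the constant [M] is subtracted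
    afterwards, being invariant under the heat flow. The kernel formula is valid only for [s < t],
    so the argument runs on the open interval. *)
Lemma measurable_heat_section g x t : jointly_bounded_measurable g ->
  measurable_fun `[0, t]%classic
    ((fun s => heat (t - s) (g s) x) : measurableTypeR R -> R).
Proof.
move=> jg; have [mg [M gM]] := jg.
(* Inverses are written as powers [-1], so that [measurable_powR] gives joint measurability; [k]
   agrees with the Gaussian where [t - s > 0]. *)
pose k (z : measurableTypeR R * measurableTypeR R) : R :=
  (Num.sqrt ((t - z.1) * (pi *+ 2))) `^ (-1) *
  expR (- (z.2 - x) ^+ 2 * ((t - z.1) * 2) `^ (-1)).
have m1 : measurable_fun [set: measurableTypeR R * measurableTypeR R] (fun z => t - z.1 : R).
  by apply: measurable_funB => //; exact: measurable_fst.
have m2 : measurable_fun [set: measurableTypeR R * measurableTypeR R] (fun z => z.2 - x : R).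
  by apply: measurable_funB => //; exact: measurable_snd.
have mk : measurable_fun [set: measurableTypeR R * measurableTypeR R] k.
  apply: measurable_funM.
    apply: (measurableT_comp (measurable_powR _)).
    apply: (measurableT_comp (continuous_measurable_fun (@sqrt_continuous R))).
    exact: measurable_funM.
  apply: measurableT_comp => //=.
  apply: measurable_funM.
    by apply: measurable_funN; exact: measurable_funX.
  apply: (measurableT_comp (measurable_powR _)).
  exact: measurable_funM.
have kE (s y : R) : 0 < t - s -> normal_pdf x (Num.sqrt (t - s)) y = k (s, y).
  move=> ts; rewrite gaussE// /k /= !powR_inv1 ?sqrtr_ge0 ?mulr_ge0 ?(ltW ts)//.
  have e1 : (t - s) * pi *+ 2 = (t - s) * (pi *+ 2) :> R by ring.
  have e2 : (t - s) *+ 2 = (t - s) * 2 :> R by ring.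
  by rewrite e1 e2.
pose f (z : measurableTypeR R * measurableTypeR R) : \bar R := (k z * (g z.1 z.2 + M))%:E.
have mf : measurable_fun setT f.
  apply/measurable_EFinP; apply: measurable_funM => //.
  exact: measurable_funD.
have f0 z : (0 <= f z)%E.
  rewrite lee_fin mulr_ge0//.
    by rewrite mulr_ge0 ?powR_ge0 ?expR_ge0.
  by have := gM z.1 z.2; rewrite ler_norml => /andP[+ _]; lra.
have mI : measurable_fun [set: measurableTypeR R] (fubini_F mu f).
  exact: measurable_fun_fubini_tonelli_F.
suff : measurable_fun `]0, t[%classic
    ((fun s => heat (t - s) (g s) x) : measurableTypeR R -> R).
  by move/measurable_fun_itv_cc.
apply: (@eq_measurable_fun _ _ _ _ _ (fun s => fine (fubini_F mu f s) - M)).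
  move=> s; rewrite inE/= in_itv/= => /andP[s0 st].
  have ts : 0 < t - s by rewrite subr_gt0.
  have bg := jbm_section s jg.
  rewrite -[RHS](addrK M) -[in RHS](@heat_cst _ (t - s) M x) ?ltW//.
  rewrite -heatD ?ltW//; last exact: bmf_cst.
  rewrite heatE// heat_cst ?ltW//; congr (fine _ - _).
  by apply: eq_integral => y _; rewrite /f (kE s y).
apply: measurable_funB => //.
apply: measurable_funTS; apply: measurableT_comp mI.
exact: fine_measurable.
Qed.

Lemma norm_heat_le g x t (M : R) s : 0 <= t -> jointly_bounded_measurable g ->
  (forall s y, `|g s y| <= M) -> `|heat t (g s) x| <= M.
Proof.
move=> t0 jg gM; have bg := jbm_section s jg.
rewrite ler_norml -[X in X <= _](@heat_cst _ t (- M) x)// -[X in _ && (_ <= X)](@heat_cst _ t M x)//.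
apply/andP; split; apply: le_heat => //; try exact: bmf_cst.
  by move=> y; have := gM s y; rewrite ler_norml => /andP[].
by move=> y; have := gM s y; rewrite ler_norml => /andP[].
Qed.

Lemma expR_killed_le1 zeta t s : 0 <= zeta -> s <= t -> 0 <= expR (- (zeta * (t - s))) <= 1.
Proof.
move=> z0 st; rewrite expR_ge0/= -expR0 ler_expR oppr_le0 mulr_ge0// subr_ge0//.
Qed.

Lemma measurable_killed zeta t : measurable_fun [set: measurableTypeR R]
  (fun s : measurableTypeR R => expR (- (zeta * (t - s))) : R).
Proof.
apply: measurableT_comp => //=; apply: measurable_funN.
by apply: measurable_funM => //; apply: measurable_funB.
Qed.

Lemma integrable_killedM zeta t (f : R -> R) (M : R) : 0 <= zeta ->
  measurable_fun `[0, t]%classic (f : measurableTypeR R -> R) ->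
  (forall s, 0 <= s <= t -> `|f s| <= M) ->
  mu.-integrable `[0, t] (EFin \o (fun s => expR (- (zeta * (t - s))) * f s)).
Proof.
move=> z0 mf fM; apply: (@itv_bounded_integrable _ _ _ M).
  by apply: measurable_funM => //; apply: measurable_funTS; exact: measurable_killed.
move=> s /andP[s0 st]; rewrite normrM.
have /andP[e0 e1] := expR_killed_le1 z0 st.
rewrite (ger0_norm e0) -[M]mul1r ler_pM// fM//.
by rewrite s0.
Qed.

Lemma Rintegral_itv_oo_cc (f : R -> R) (a b : R) :
  mu.-integrable `[a, b] (EFin \o f) ->
  \int[mu]_(s in `[a, b]) f s = \int[mu]_(s in `]a, b[) f s.
Proof.
move=> fi.
rewrite -Rintegral_itv_obnd_cbnd; last first.
  by apply: integrableS fi => //; apply: subset_itv; rewrite bnd_simp.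
rewrite -Rintegral_itv_bndo_bndc//.
by apply: integrableS fi => //; apply: subset_itv; rewrite bnd_simp.
Qed.

(** End points are null, so nothing is asked at [s = 0], where the barriers are not assumed to be
    ordered or odd. *)
Lemma le_duhamel zeta t x g1 g2 (h : R -> R) (N : R) : 0 <= zeta ->
  jointly_bounded_measurable g1 -> jointly_bounded_measurable g2 ->
  measurable_fun `[0, t]%classic (h : measurableTypeR R -> R) ->
  (forall s, 0 <= s <= t -> `|h s| <= N) ->
  (forall s, 0 < s < t -> heat (t - s) (g1 s) x <= heat (t - s) (g2 s) x + h s) ->
  \int[mu]_(s in `[0, t]) killed_heat zeta (t - s) (g1 s) x <=
  \int[mu]_(s in `[0, t]) killed_heat zeta (t - s) (g2 s) x +
  \int[mu]_(s in `[0, t]) (expR (- (zeta * (t - s))) * h s).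
Proof.
move=> z0 j1 j2 mh hN H.
have i1 g : jointly_bounded_measurable g ->
  mu.-integrable `[0, t] (EFin \o (fun s => killed_heat zeta (t - s) (g s) x)).
  move=> jg; have [mg [M gM]] := jg.
  apply: (@integrable_killedM _ _ _ M) => //; first exact: measurable_heat_section.
  by move=> s /andP[s0 st]; apply: norm_heat_le; rewrite ?subr_ge0.
have ih := integrable_killedM z0 mh hN.
rewrite -RintegralD//; [|exact: i1..].
have mI : measurable (`[0, t]%classic : set (measurableTypeR R)) by [].
have iD : mu.-integrable `[0, t] (EFin \o (fun s => killed_heat zeta (t - s) (g2 s) x + expR (- (zeta * (t - s))) * h s)).
  exact: (integrableD mI (i1 _ j2) ih).
rewrite (Rintegral_itv_oo_cc (i1 _ j1)) (Rintegral_itv_oo_cc iD).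
have sub : `]0, t[%classic `<=` `[0, t]%classic by apply: subset_itv; rewrite bnd_simp.
apply: le_Rintegral => //.
- exact: (integrableS mI _ sub (i1 _ j1)).
- exact: (integrableS mI _ sub iD).
- move=> s /=; rewrite in_itv/= => st.
  by rewrite /killed_heat -mulrDr ler_wpM2l ?expR_ge0// H.
Qed.

End duhamel.

(** * Exponential errors and the Gronwall iteration *)

Section duhamel_expR.
Context {R : realType}.
Notation mu := (@lebesgue_measure R).
Implicit Types (g h : R -> R -> R) (t x zeta : R).

Lemma duhamel_expR zeta t (c la : R) : 0 <= t -> zeta + la != 0 ->
  \int[mu]_(s in `[0, t]) (expR (- (zeta * (t - s))) * (c * expR (la * s))) =
  c * (expR (la * t) - expR (- (zeta * t))) / (zeta + la).
Proof.
move=> t0 zl.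
pose F (s : R) := c / (zeta + la) * expR ((zeta + la) * s - zeta * t).
have fE s : expR (- (zeta * (t - s))) * (c * expR (la * s)) =
    c * expR ((zeta + la) * s - zeta * t).
  by rewrite mulrCA -expRD; congr (_ * expR _); ring.
under eq_Rintegral do rewrite fE.
have dF (y : R) : is_derive y (1 : R) F (c * expR ((zeta + la) * y - zeta * t)).
  by rewrite /F; apply: is_derive_eq; rewrite /GRing.scale/=; field.
rewrite (Rintegral_FTC t0 (fun y _ => dF y)).
- rewrite /F mulr0 sub0r -mulrBr mulrAC; congr (_ * (expR _ - _) / _); ring.
- apply: continuous_subspaceT => y; apply: cvgM; first exact: cvg_cst.
  apply: continuous_comp; last exact: continuous_expR.
  by apply: cvgB; [apply: cvgM; [exact: cvg_cst|exact: cvg_id]|exact: cvg_cst].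
Qed.

Lemma le_duhamel_expR zeta t x g1 g2 (c la : R) : 0 <= zeta -> 0 <= t ->
  zeta + la != 0 ->
  jointly_bounded_measurable g1 -> jointly_bounded_measurable g2 ->
  (forall s, 0 < s < t ->
     heat (t - s) (g1 s) x <= heat (t - s) (g2 s) x + c * expR (la * s)) ->
  \int[mu]_(s in `[0, t]) killed_heat zeta (t - s) (g1 s) x <=
  \int[mu]_(s in `[0, t]) killed_heat zeta (t - s) (g2 s) x +
  c * (expR (la * t) - expR (- (zeta * t))) / (zeta + la).
Proof.
move=> z0 t0 zl j1 j2 H; rewrite -duhamel_expR//.
apply: (@le_duhamel _ _ _ _ _ _ _ (`|c| * expR (`|la| * t))) => //.
- apply: measurable_funM => //; apply: measurable_funTS.
  by apply: measurableT_comp => //; exact: measurable_funM.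
- move=> s /andP[s0 st]; rewrite normrM ler_wpM2l// ger0_norm ?expR_ge0//.
  rewrite ler_expR (le_trans (ler_norm _))// normrM (ger0_norm s0).
  by rewrite ler_wpM2l.
Qed.

(** Gronwall's inequality in a weighted supremum norm: a bound [M exp (la t)] that always improves
    by a factor 2 iterates to 0, starting from the crude bound [B]. *)
Lemma halving_le0 (Q : R -> R -> Prop) (d : R -> R -> R) (B la : R) :
  0 <= la -> 0 <= B -> (forall t x, Q t x -> 0 <= t /\ d t x <= B) ->
  (forall M, 0 <= M -> (forall t x, Q t x -> d t x <= M * expR (la * t)) ->
     forall t x, Q t x -> d t x <= M / 2 * expR (la * t)) ->
  forall t x, Q t x -> d t x <= 0.
Proof.
move=> la0 B0 dB step t x Qtx.
have H n : forall t x, Q t x -> d t x <= B * (2^-1) ^+ n * expR (la * t).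
  elim: n => [|n IH] {Qtx}t {}x Qtx.
    have [t0 dtB] := dB _ _ Qtx; rewrite expr0 mulr1 (le_trans dtB)// ler_peMr//.
    by rewrite -expR0 ler_expR mulr_ge0.
  rewrite exprSr mulrA; apply: step Qtx => //.
  by rewrite mulr_ge0// exprn_ge0.
apply/ler_addgt0Pl => e e0; rewrite addr0.
have [n hn] : exists n, B * expR (la * t) * (2^-1) ^+ n < e.
  have : (fun n => B * expR (la * t) * (2^-1) ^+ n) @ \oo --> (0 : R).
    rewrite -[X in _ --> X](mulr0 (B * expR (la * t))).
    apply: cvgM; first exact: cvg_cst.
    by apply: cvg_expr; rewrite ger0_norm//; lra.
  move=> /cvgrPdist_lt /(_ _ e0) [n _ /(_ n (leqnn n))] /=.
  rewrite sub0r normrN => h; exists n; exact: le_lt_trans (ler_norm _) h.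
by apply: le_trans (H n _ _ Qtx) _; rewrite mulrAC ltW.
Qed.

End duhamel_expR.

(** * Comparison for the mild equation *)

Section comparison.
Context {R : realType} (zeta gamma : R) (z0 : 0 < zeta).
Notation mu := (@lebesgue_measure R).
Implicit Types (u v g : R -> R -> R) (t x : R) (F : R -> R).

Definition source F u s y := F (u s (gamma^-1 * y)).

Definition duhamel F u t x :=
  killed_heat zeta t (@Num.sg R) x +
  zeta * \int[mu]_(s in `[0, t]) killed_heat zeta (t - s) (source F u s) x.

(* The comparison principle, on the whole line ([P] trivially true) or, for
   odd functions, on the half line. *)
Lemma comparison (P : R -> Prop) (F1 F2 : R -> R) (L B : R) u v : 0 < L ->
  jointly_bounded_measurable (source F1 u) ->
  jointly_bounded_measurable (source F2 v) ->
  (forall x, P x -> P (gamma^-1 * x)) ->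
  (forall r s x c, 0 <= r -> 0 < s -> 0 <= c -> P x ->
    (forall y, P y -> source F1 u s y <= source F2 v s y + c) ->
    heat r (source F1 u s) x <= heat r (source F2 v s) x + c) ->
  (forall s x c, 0 < s -> P x -> 0 <= c -> u s x <= v s x + c ->
     F1 (u s x) <= F2 (v s x) + L * c) ->
  0 <= B -> (forall t x, 0 < t -> P x -> u t x - v t x <= B) ->
  (forall t x, 0 < t -> P x -> u t x <= duhamel F1 u t x) ->
  (forall t x, 0 < t -> P x -> duhamel F2 v t x <= v t x) ->
  forall t x, 0 < t -> P x -> u t x <= v t x.
Proof.
move=> L0 j1 j2 Pg Hh HF B0 uvB subu supv t x t0 Px.
(* The Duhamel integral turns an error [M exp (la s)] into at most
   [zeta L M exp (la t) / (zeta + la)]; this [la] makes the factor at most one half. *)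
pose la := 2 * zeta * L.
have la0 : 0 < la by rewrite !mulr_gt0.
rewrite -subr_le0.
apply: (@halving_le0 R (fun t x => 0 < t /\ P x) (fun t x => u t x - v t x) B la) => //.
- exact: ltW.
- by move=> ? ? [? ?]; split; [exact: ltW|exact: uvB].
move=> M M0 HM {Px}t {}x {t0}[t0 Px].
have zl : zeta + la != 0 by rewrite gt_eqF// addr_gt0.
have := @le_duhamel_expR R zeta t x _ _ (L * M) la (ltW z0) (ltW t0) zl j1 j2.
move=> D.
have {}D : \int[mu]_(s in `[0, t]) killed_heat zeta (t - s) (source F1 u s) x <=
  \int[mu]_(s in `[0, t]) killed_heat zeta (t - s) (source F2 v s) x +
  L * M * (expR (la * t) - expR (- (zeta * t))) / (zeta + la).
  apply: D => s /andP[s0 st]; rewrite -mulrA.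
  have c0 : 0 <= L * (M * expR (la * s)).
    by rewrite mulr_ge0 ?(ltW L0)// mulr_ge0// expR_ge0.
  apply: Hh => //; first by rewrite subr_ge0 ltW.
  move=> y Py; apply: HF => //; first exact: Pg.
    by rewrite mulr_ge0// expR_ge0.
  by rewrite -lerBlDl; apply: HM; split => //; exact: Pg.
have uD := subu _ _ t0 Px; have vD := supv _ _ t0 Px.
rewrite /duhamel in uD vD.
set I1 := \int[mu]_(s in _) _ in uD D; set I2 := \int[mu]_(s in _) _ in vD D.
have : u t x - v t x <= zeta * (I1 - I2).
  by rewrite mulrBr; lra.
move/le_trans; apply.
have : zeta * (I1 - I2) <= zeta * (L * M * (expR (la * t) - expR (- (zeta * t))) / (zeta + la)).
  by rewrite ler_wpM2l ?(ltW z0)//; lra.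
move/le_trans; apply.
rewrite mulrA ler_pdivrMr ?addr_gt0//.
have E0 := expR_ge0 (la * t); have E1 := expR_ge0 (- (zeta * t)).
have ML : 0 <= zeta * (L * M) by rewrite mulr_ge0 ?(ltW z0)// mulr_ge0// ltW.
have h1 : zeta * (L * M * (expR (la * t) - expR (- (zeta * t)))) <= zeta * (L * M) * expR (la * t).
  by rewrite mulrA ler_wpM2l//; lra.
apply: (le_trans h1); rewrite /la.
have ME : 0 <= M * expR (2 * zeta * L * t) by rewrite mulr_ge0// expR_ge0.
have -> : M / 2 * expR (2 * zeta * L * t) * (zeta + 2 * zeta * L) =
  zeta * (L * M) * expR (2 * zeta * L * t) + zeta / 2 * (M * expR (2 * zeta * L * t)) by field.
by rewrite lerDl mulr_ge0// divr_ge0// ltW.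
Qed.

Lemma heat_line r s x c g1 g2 : 0 <= r ->
  bounded_measurable (g1 s) -> bounded_measurable (g2 s) ->
  (forall y, g1 s y <= g2 s y + c) ->
  heat r (g1 s) x <= heat r (g2 s) x + c.
Proof.
move=> r0 b1 b2 H; rewrite -[X in _ + X](@heat_cst R r c x)// -heatD//; last exact: bmf_cst.
by apply: le_heat => //; apply: bmfD => //; exact: bmf_cst.
Qed.

Lemma heat_sg_ge0_le1 t x : 0 <= t -> 0 <= x -> 0 <= heat t (@Num.sg R) x <= 1.
Proof.
move=> t0 x0; apply/andP; split.
  apply: heat_odd_ge0 => //; [exact: bmf_sg|by move=> y; rewrite sgrN|].
  by move=> y y0; rewrite sgr_ge0.
rewrite -[leRHS](@heat_cst R t 1 x)//; apply: le_heat => //.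
- exact: bmf_sg.
- exact: bmf_cst.
- by move=> y; rewrite (le_trans (ler_norm _))// normr_sg; case: (_ != 0).
Qed.

(** [c * Num.sg] is the odd extension of the constant [c], so [g2 + c sg - g1] is odd and
    nonnegative on the half line, and [heat_odd_ge0] applies. *)
Lemma heat_half_line t x c (g1 g2 : R -> R) : 0 <= t -> 0 <= x -> 0 <= c ->
  bounded_measurable g1 -> bounded_measurable g2 ->
  (forall y, g1 (- y) = - g1 y) -> (forall y, g2 (- y) = - g2 y) ->
  (forall y, 0 <= y -> g1 y <= g2 y + c) ->
  heat t g1 x <= heat t g2 x + c * heat t (@Num.sg R) x.
Proof.
move=> t0 x0 c0 b1 b2 o1 o2 H; rewrite -subr_ge0.
have bs := @bmf_sg R.
rewrite -heatZ// -heatD//; last exact: bmfZ.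
rewrite -heatN// -heatD//; last 2 first.
- by apply: bmfD => //; exact: bmfZ.
- exact: bmfN.
apply: heat_odd_ge0 => //.
- by apply: bmfD; [apply: bmfD => //; exact: bmfZ|exact: bmfN].
- by move=> y; rewrite o1 o2 sgrN; ring.
- move=> y; rewrite le_eqVlt => /predU1P[<-|y0].
    have g0 (g : R -> R) : (forall y, g (- y) = - g y) -> g 0 = 0.
      by move=> /(_ 0); rewrite oppr0; lra.
    by rewrite (g0 _ o1) (g0 _ o2) sgr0; lra.
  by have := H _ (ltW y0); rewrite gtr0_sg//; lra.
Qed.

Lemma heat_half_line_cst t x c (g1 g2 : R -> R) : 0 <= t -> 0 <= x -> 0 <= c ->
  bounded_measurable g1 -> bounded_measurable g2 ->
  (forall y, g1 (- y) = - g1 y) -> (forall y, g2 (- y) = - g2 y) ->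
  (forall y, 0 <= y -> g1 y <= g2 y + c) ->
  heat t g1 x <= heat t g2 x + c.
Proof.
move=> t0 x0 c0 b1 b2 o1 o2 H.
apply: le_trans (heat_half_line t0 x0 c0 b1 b2 o1 o2 H) _.
have /andP[s0 s1] := heat_sg_ge0_le1 t0 x0.
by rewrite lerD2l ler_piMr.
Qed.

End comparison.

(** * Truncation to [[-1, 1]] *)

Section clamp.
Context {R : realType}.
Implicit Types a b c v : R.

(** Composed with [F], which is controlled only on [[-1, 1]], it gives a nonlinearity that is odd,
    monotone and Lipschitz on the whole line; applied to a barrier it ensures boundedness. *)
Definition clamp v : R := Num.max (-1) (Num.min 1 v).

Lemma clampP v : [\/ v <= -1 /\ clamp v = -1, -1 <= v <= 1 /\ clamp v = v |
  1 <= v /\ clamp v = 1].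
Proof.
rewrite /clamp; have [v1|v1] := leP 1 v; first by apply: Or33; rewrite max_r//; lra.
have [v2|v2] := leP (-1) v; first by apply: Or32; split => //; lra.
by apply: Or31; split => //; lra.
Qed.

Lemma clampN v : clamp (- v) = - clamp v.
Proof. by case: (clampP v) => -[+ ->]; case: (clampP (- v)) => -[+ ->]; lra. Qed.

Lemma clamp_bounds v : -1 <= clamp v <= 1.
Proof. by case: (clampP v) => -[+ ->]; lra. Qed.

Lemma norm_clamp_le1 v : `|clamp v| <= 1.
Proof. by rewrite ler_norml clamp_bounds. Qed.

Lemma clamp_id v : -1 <= v <= 1 -> clamp v = v.
Proof. by case: (clampP v) => -[+ ->]; lra. Qed.

Lemma clamp_le_shift a b c : 0 <= c -> a <= b + c -> clamp a <= clamp b + c.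
Proof.
by case: (clampP a) => -[+ ->]; case: (clampP b) => -[+ ->]; lra.
Qed.

Lemma clamp_le v : 0 <= v -> 0 <= clamp v <= v.
Proof. by case: (clampP v) => -[+ ->]; lra. Qed.

Lemma le_clamp : {homo clamp : a b / a <= b}.
Proof. by move=> a b ab; rewrite -[leRHS]addr0 clamp_le_shift// addr0. Qed.

End clamp.

(** * Oddness and positivity of the mild solution; comparison with odd barriers *)

Section mild.
Context {R : realType} (zeta gamma : R) (z0 : 0 < zeta) (gamma1 : 1 < gamma).
Notation mu := (@lebesgue_measure R).
Context (F : R -> R) (L : R) (L0 : 0 < L).
Hypothesis F_odd : forall v, F (- v) = - F v.
Hypothesis F_homo : {homo F : a b / a <= b}.
Hypothesis F_lip : forall a b c, 0 <= c -> a <= b + c -> F a <= F b + L * c.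
Hypothesis F_le1 : forall v, `|F v| <= 1.
Context (u : R -> R -> R).
Hypothesis u_jbm : jointly_bounded_measurable u.
Hypothesis u_le1 : forall t x, `|u t x| <= 1.
Hypothesis u_mild : forall t x, 0 <= t -> u t x = duhamel zeta gamma F u t x.

Lemma gammaV_ge0 : 0 <= gamma^-1. Proof. by rewrite invr_ge0; have := gamma1; lra. Qed.

Lemma source_jbm (G : R -> R) (w : R -> R -> R) (B : R) : {homo G : a b / a <= b} ->
  (forall v, `|G v| <= B) -> jointly_bounded_measurable w ->
  jointly_bounded_measurable (source gamma G w).
Proof.
move=> Gh GB jw; split; last by exists B => s y; exact: GB.
have mG : measurable_fun [set: R] G by apply: nondecreasing_measurable => // a b _ _; exact: Gh.
have [mw _] : jointly_bounded_measurable (fun s y => w s (gamma^-1 * y)).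
  by apply: jbm_comp => //; exact: measurable_funM.
exact: (measurableT_comp mG mw).
Qed.

Lemma Rintegral00 (f : R -> R) : \int[mu]_(s in `[0, 0]) f s = 0.
Proof. by rewrite set_itv1 Rintegral_set1. Qed.

Lemma mild0 x : u 0 x = Num.sg x.
Proof.
rewrite u_mild// /duhamel Rintegral00 mulr0 addr0 /killed_heat heat0.
by rewrite mulr0 oppr0 expR0 mul1r.
Qed.

Lemma duhamel_odd t x : 0 <= t ->
  duhamel zeta gamma F (fun s y => - u s (- y)) t x = - u t (- x).
Proof.
move=> t0; rewrite (u_mild _ t0) /duhamel opprD.
have bs := @bmf_sg R.
have js := source_jbm F_homo F_le1 u_jbm.
congr (_ + _).
  by rewrite /killed_heat heat_odd// ?mulrN ?opprK// => y; rewrite sgrN.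
rewrite -mulrN; congr (_ * _).
have iG : mu.-integrable `[0, t] (EFin \o (fun s => killed_heat zeta (t - s) (source gamma F u s) (- x))).
  apply: (@integrable_killedM _ _ _ _ 1) => //; [exact: ltW|exact: measurable_heat_section|].
  by move=> s /andP[s0 st]; apply: norm_heat_le; rewrite ?subr_ge0// => *; exact: F_le1.
rewrite -mulN1r -RintegralZl//; apply: eq_Rintegral => s.
rewrite inE/= in_itv/= => /andP[s0 st]; rewrite mulN1r /killed_heat -[RHS]mulrN; congr (_ * _).
have ts : 0 <= t - s by rewrite subr_ge0.
have b := jbm_section s js.
rewrite -heatN// -(heat_refl 0 (- x))//; last exact: bmfN.
rewrite sub0r opprK; congr heat; apply/funext => y.
by rewrite /source F_odd sub0r mulrN.
Qed.

(** [- u t (- x)] solves the same equation, so this is uniqueness. Half-line comparison presupposes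
    oddness; hence the whole-line version is used, in both directions. *)
Lemma mild_odd t x : 0 <= t -> u t (- x) = - u t x.
Proof.
rewrite le_eqVlt => /predU1P[<-|t0]; first by rewrite !mild0 sgrN.
pose v := fun s y => - u s (- y).
have v_jbm : jointly_bounded_measurable v.
  have [mv _] : jointly_bounded_measurable (fun s y => u s (- y)).
    by apply: jbm_comp => //; exact: measurable_funN.
  split; first exact: measurable_funN.
  by exists 1 => s y; rewrite normrN.
have v_le1 s y : `|v s y| <= 1 by rewrite normrN.
have jv := source_jbm F_homo F_le1 v_jbm.
have ju := source_jbm F_homo F_le1 u_jbm.
have cmp w1 w2 : jointly_bounded_measurable (source gamma F w1) ->
    jointly_bounded_measurable (source gamma F w2) ->
    (forall s y, `|w1 s y| <= 1) -> (forall s y, `|w2 s y| <= 1) ->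
    (forall s y, 0 < s -> w1 s y = duhamel zeta gamma F w1 s y) ->
    (forall s y, 0 < s -> w2 s y = duhamel zeta gamma F w2 s y) ->
    forall y, w1 t y <= w2 t y.
  move=> j1 j2 w11 w21 d1 d2 y.
  apply: (@comparison _ _ gamma z0 (fun=> True) F F L 2) => //.
  - move=> r s {}y c r0 s0 c0 _ H; apply: heat_line => //; [exact: jbm_section|exact: jbm_section|].
    by move=> y'; exact: H.
  - by move=> *; apply: F_lip.
  - move=> s y' s0 _; have := w11 s y'; have := w21 s y'; rewrite !ler_norml; lra.
  - by move=> s y' s0 _; rewrite -d1.
  - by move=> s y' s0 _; rewrite -d2.
have dv s y : 0 < s -> v s y = duhamel zeta gamma F v s y.
  by move=> s0; rewrite duhamel_odd// ltW.
have du s y : 0 < s -> u s y = duhamel zeta gamma F u s y.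
  by move=> s0; rewrite -u_mild// ltW.
have : u t x = v t x.
  apply: le_anti; apply/andP; split.
    exact: cmp ju jv u_le1 v_le1 du dv _.
  exact: cmp jv ju v_le1 u_le1 dv du _.
by rewrite /v => ->; rewrite opprK.
Qed.

Lemma source_odd (G : R -> R) w s : (forall v, G (- v) = - G v) ->
  (forall y, w s (- y) = - w s y) ->
  forall y, source gamma G w s (- y) = - source gamma G w s y.
Proof. by move=> oG ow y; rewrite /source mulrN ow oG. Qed.

Lemma subsolution_le (w : R -> R -> R) : jointly_bounded_measurable w ->
  (forall s y, 0 < s -> w s (- y) = - w s y) ->
  (forall s y, w s y <= 1) ->
  (forall t x, 0 < t -> 0 <= x -> w t x <= duhamel zeta gamma F w t x) ->
  forall t x, 0 < t -> 0 <= x -> w t x <= u t x.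
Proof.
move=> jw ow w1 dw; apply: (@comparison _ _ gamma z0 (fun x => 0 <= x) F F L 2) => //.
- exact: source_jbm F_le1 jw.
- exact: source_jbm F_le1 u_jbm.
- by move=> x x0; rewrite mulr_ge0// gammaV_ge0.
- move=> r s x c r0 s0 c0 x0 H; apply: heat_half_line_cst => //.
  + exact/jbm_section/(source_jbm _ F_le1 jw).
  + exact/jbm_section/(source_jbm _ F_le1 u_jbm).
  + by apply: source_odd => // y; exact: ow.
  + by apply: source_odd => // y; apply: mild_odd; exact: ltW.
- by move=> *; exact: F_lip.
- by move=> s y s0 _; have := u_le1 s y; have := w1 s y; rewrite ler_norml; lra.
- by move=> s y s0 _; rewrite -u_mild// ltW.
Qed.

Lemma mild_ge0 t x : 0 <= t -> 0 <= x -> 0 <= u t x.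
Proof.
rewrite le_eqVlt => /predU1P[<-|t0] x0; first by rewrite mild0 sgr_ge0.
apply: (@subsolution_le (fun _ _ => 0)) => //.
- by split; [exact: measurable_cst|exists 0 => *; rewrite normr0].
- by move=> *; rewrite oppr0.
- move=> s y s0 y0.
  have F00 : F 0 = 0 by have := F_odd 0; rewrite oppr0; lra.
  rewrite /duhamel addr_ge0//.
    by rewrite mulr_ge0 ?expR_ge0//; have /andP[] := heat_sg_ge0_le1 (ltW s0) y0.
  rewrite mulr_ge0 ?(ltW z0)//; apply: Rintegral_ge0 => r /=.
  rewrite in_itv/= => /andP[r0 rs].
  by rewrite /killed_heat mulr_ge0 ?expR_ge0// /source F00 heat_cst// subr_ge0.
Qed.

(** The two sides obey different nonlinearities: on [[0, 1]], [F] lies below the [Y]-Lipschitz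
    function [clamp (Y * v)]. Positivity of [u] on the half line keeps its values in that range. *)
Lemma supersolution_ge (Y : R) (w : R -> R -> R) : 0 < Y ->
  (forall v, 0 <= v <= 1 -> F v <= Y * v) ->
  jointly_bounded_measurable w ->
  (forall s y, 0 < s -> w s (- y) = - w s y) ->
  (forall s y, 0 < s -> 0 <= y -> 0 <= w s y) ->
  (forall t x, 0 < t -> 0 <= x ->
     duhamel zeta gamma (fun v => clamp (Y * v)) w t x <= w t x) ->
  forall t x, 0 < t -> 0 <= x -> u t x <= w t x.
Proof.
move=> Y0 FY jw ow w0 dw.
have hc : {homo (fun v => clamp (Y * v)) : a b / a <= b}.
  by move=> a b ab; apply: le_clamp; rewrite ler_pM2l.
have c1 v : `|clamp (Y * v)| <= 1 by exact: norm_clamp_le1.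
apply: (@comparison _ _ gamma z0 (fun x => 0 <= x) F (fun v => clamp (Y * v)) Y 1) => //.
- exact: source_jbm F_le1 u_jbm.
- exact: source_jbm c1 jw.
- by move=> x x0; rewrite mulr_ge0// gammaV_ge0.
- move=> r s x c r0 s0 c0 x0 H; apply: heat_half_line_cst => //.
  + exact/jbm_section/(source_jbm _ F_le1 u_jbm).
  + exact/jbm_section/(source_jbm _ c1 jw).
  + by apply: source_odd => // y; apply: mild_odd; exact: ltW.
  + apply: source_odd; last by move=> y; exact: ow.
    by move=> v; rewrite mulrN clampN.
- move=> s x c s0 x0 c0 uw.
  have u0 := mild_ge0 (ltW s0) x0.
  have u1 : u s x <= 1 by have := u_le1 s x; rewrite ler_norml => /andP[].
  have Fu : F (u s x) <= clamp (Y * u s x).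
    have := FY _ (introT andP (conj u0 u1)).
    have := F_le1 (u s x); rewrite ler_norml => /andP[_ F1].
    by case: (clampP (Y * u s x)) => -[+ ->]; have := mulr_ge0 (ltW Y0) u0; lra.
  apply: (le_trans Fu); apply: clamp_le_shift; first by rewrite mulr_ge0// ltW.
  by rewrite -mulrDr ler_pM2l.
- by move=> s y s0 y0; have := u_le1 s y; have := w0 s y s0 y0; rewrite ler_norml; lra.
- by move=> s y s0 _; rewrite -u_mild// ltW.
Qed.

End mild.

Lemma measurable_clamp {R : realType} : measurable_fun [set: R] (@clamp R).
Proof.
apply: nondecreasing_measurable; first exact: measurableT.
by move=> a c ac; exact: le_clamp.
Qed.

(** * The odd power [x ^ w] and its decrease under the heat flow *)

Section signed_power.
Context {R : realType} (w : R) (w0 : 0 < w) (w1 : w <= 1).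
Implicit Types a b x y z : R.

Definition spow y := Num.sg y * `|y| `^ w.

Lemma spow_odd y : spow (- y) = - spow y.
Proof. by rewrite /spow sgrN normrN mulNr. Qed.

Lemma spowE y : 0 <= y -> spow y = y `^ w.
Proof.
rewrite /spow le_eqVlt => /predU1P[<-|y0]; first by rewrite sgr0 mul0r powR0// gt_eqF.
by rewrite gtr0_sg// mul1r gtr0_norm.
Qed.

Lemma spow_ge0 y : 0 <= y -> 0 <= spow y.
Proof. by move=> y0; rewrite spowE// powR_ge0. Qed.

Lemma spowM a y : 0 <= a -> spow (a * y) = a `^ w * spow y.
Proof.
rewrite /spow le_eqVlt => /predU1P[<-|a0].
  by rewrite mul0r sgr0 mul0r powR0 ?gt_eqF// mul0r.
by rewrite sgrM gtr0_sg// mul1r normrM powRM// gtr0_norm// mulrCA.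
Qed.

(** A ratio in [[0, 1]] is at most its power [w]; apply this to [a / (a + b)] and [b / (a + b)],
    which add up to 1. *)
Lemma powR_subadditive a b : 0 <= a -> 0 <= b -> (a + b) `^ w <= a `^ w + b `^ w.
Proof.
move=> a0 b0; have [ab|ab] := leP (a + b) 0.
  have -> : a = 0 by lra.
  have -> : b = 0 by lra.
  by rewrite addr0 lerDl powR_ge0.
have key c : 0 <= c -> c <= a + b -> (a + b) `^ w * (c / (a + b)) <= c `^ w.
  rewrite le_eqVlt => /predU1P[<- _|c0 cab]; first by rewrite mul0r mulr0 powR_ge0.
  rewrite -{2}(divfK (lt0r_neq0 ab) c) powRM ?divr_ge0 ?(ltW c0) ?(ltW ab)//.
  rewrite mulrC ler_wpM2r ?powR_ge0// ger1_powR// divr_gt0//=.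
  by rewrite ler_pdivrMr// mul1r.
have := key a a0; have := key b b0; rewrite lerDl lerDr => /(_ a0) kb /(_ b0) ka.
apply: le_trans (lerD ka kb); rewrite -mulrDr -mulrDl divff ?mulr1//.
exact: lt0r_neq0.
Qed.

(** The tangent inequality of a concave function, obtained from Young's inequality for [(y / x) ^ w]
    and 1 with exponents [1 / w] and [1 / (1 - w)]. *)
Lemma powR_tangent x y : 0 < x -> 0 <= y -> y `^ w <= x `^ w * (1 + w * (y / x - 1)).
Proof.
move=> x0 y0; have r0 : 0 <= y / x by rewrite divr_ge0// ltW.
have -> : y `^ w = x `^ w * (y / x) `^ w.
  by rewrite -powRM// ?(ltW x0)// mulrC divfK// lt0r_neq0.
rewrite ler_wpM2l ?powR_ge0//.
have [->|wn1] := eqVneq w 1; first by rewrite powRr1//; lra.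
have w1' : w < 1 by rewrite lt_neqAle wn1.
have := @conjugate_powR R ((y / x) `^ w) 1 w^-1 (1 - w)^-1 (powR_ge0 _ _) ler01.
rewrite !invr_gt0 !invrK subr_gt0 mulr1 powR1 -powRrM divff ?gt_eqF// powRr1//.
move=> /(_ w0 w1'); rewrite mul1r addrC subrK => /(_ erefl); lra.
Qed.

(** The odd extension is not concave on the line, yet the inequality holds at every centre [x >= 0].
    For [z <= x] add two tangent inequalities at [x]; for [z > x] use
    [(x + z) ^ w <= (z - x) ^ w + (2 x) ^ w]. *)
Lemma spow_midconcave x z : 0 <= x -> spow (x + z) + spow (x - z) <= 2 * spow x.
Proof.
move=> x0; wlog z0 : z / 0 <= z.
  move=> H; have [z0|z0] := leP 0 z; first exact: H.
  by have := H (- z); rewrite opprK addrC; apply; lra.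
move: x0; rewrite le_eqVlt => /predU1P[<-|x0].
  by rewrite add0r sub0r spow_odd subrr mulr_ge0// spow_ge0.
rewrite (spowE (ltW x0)); have [zx|xz] := leP z x.
  rewrite !spowE; [|lra..].
  have h1 := @powR_tangent x (x + z) x0; have h2 := @powR_tangent x (x - z) x0.
  have {}h1 := h1 (addr_ge0 (ltW x0) z0).
  have {}h2 : (x - z) `^ w <= x `^ w * (1 + w * ((x - z) / x - 1)) by apply: h2; lra.
  apply: (le_trans (lerD h1 h2)); rewrite -mulrDr mulrC.
  by rewrite ler_wpM2r ?powR_ge0// le_eqVlt; apply/orP; left; apply/eqP; field; exact: lt0r_neq0.
have -> : x - z = - (z - x) by ring.
rewrite spow_odd !spowE; [|lra..].
have := @powR_subadditive (z - x) (2 * x).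
have -> : z - x + 2 * x = x + z by ring.
have h2 : (2 * x) `^ w <= 2 * x `^ w.
  by rewrite powRM ?(ltW x0)// ler_wpM2r ?powR_ge0// ler1_powR// ler1n.
by move=> h; have := h ltac:(lra) ltac:(lra); lra.
Qed.

Lemma measurable_spow : measurable_fun [set: measurableTypeR R] spow.
Proof.
apply: measurable_funM; first by have [] := @bmf_sg R.
apply: (measurableT_comp (measurable_powR w)).
exact: normr_measurable.
Qed.

Lemma bmf_clamp_spow b : bounded_measurable (fun y => clamp (b * spow y)).
Proof.
split; last by exists 1 => y; exact: norm_clamp_le1.
have mc := @measurable_clamp R.
apply: (measurableT_comp mc); apply: measurable_funM => //; exact: measurable_spow.
Qed.

Lemma heat_clamp_spow_le t b x : 0 <= t -> 0 <= b -> 0 <= x ->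
  heat t (fun y => clamp (b * spow y)) x <= b * spow x.
Proof.
move=> t0 b0 x0.
have := @le_heat_quadratic R t (fun y => clamp (b * spow y)) (b * spow x) 0 x t0 (lexx _).
rewrite mulr0 addr0; apply; first exact: bmf_clamp_spow.
move=> z; rewrite mul0r addr0; wlog z0 : z / 0 <= z.
  move=> H; have [z0|z0] := leP 0 z; first exact: H.
  by have := H (- z); rewrite opprK addrC; apply; lra.
have bx : 0 <= b * spow x by rewrite mulr_ge0// spow_ge0.
have bp : clamp (b * spow (x + z)) <= b * spow (x + z).
  have : 0 <= b * spow (x + z) by rewrite mulr_ge0// spow_ge0// addr_ge0.
  by move=> /clamp_le/andP[].
have h : b * spow (x + z) + b * spow (x - z) <= 2 * (b * spow x).
  have -> : 2 * (b * spow x) = b * (2 * spow x) by ring.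
  by rewrite -mulrDr ler_wpM2l// spow_midconcave.
(* Truncation could hurt only where it raises the value at [x - z] to [-1]; then the sum is at most
   [1 - 1 = 0]. *)
case: (clampP (b * spow (x - z))) => -[+ ->]; try lra.
by have /andP[_] := clamp_bounds (b * spow (x + z)); lra.
Qed.

End signed_power.

(** * The supersolution with the correction for the initial jump *)

Section upper_barrier.
Context {R : realType} (zeta gamma Y w : R).
Hypothesis z0 : 0 < zeta.
Hypothesis gamma1 : 1 < gamma.
Hypothesis Y0 : 0 < Y.
Hypothesis w0 : 0 < w.
Hypothesis w1 : w <= 1.
Notation mu := (@lebesgue_measure R).
Implicit Types (t x s e : R).

Lemma Rintegral_le_FTC (f H H' : R -> R) t : 0 <= t ->
  mu.-integrable `[0, t] (EFin \o f) ->
  (forall s, 0 < s < t -> f s <= H' s) ->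
  (forall s, 0 <= s <= t -> is_derive s (1 : R) H (H' s)) ->
  {within `[0, t], continuous H'} ->
  \int[mu]_(s in `[0, t]) f s <= H t - H 0.
Proof.
move=> t0 fi fH dH cH; rewrite -(Rintegral_FTC t0 dH cH).
have iH : mu.-integrable `[0, t] (EFin \o H').
  by apply: continuous_compact_integrable => //; exact: segment_compact.
have mI : measurable (`[0, t]%classic : set (measurableTypeR R)) by [].
have sub : `]0, t[%classic `<=` `[0, t]%classic by apply: subset_itv; rewrite bnd_simp.
rewrite !Rintegral_itv_oo_cc//; apply: le_Rintegral => //.
- exact: (integrableS mI _ sub fi).
- exact: (integrableS mI _ sub iH).
Qed.

Definition kappa := zeta * Y * gamma `^ (- w).

Lemma kappa_gt0 : 0 < kappa.
Proof. by rewrite !mulr_gt0// powR_gt0//; have := gamma1; lra. Qed.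

(** Of order [s ^ (-1/2)] near 0, which dominates the singularity [s ^ (-w/2)] left by the jump, and
    integrable over the whole half line with integral 2. At [s = 0] it is 0, by the convention for
    inverses. *)
Definition phi s : R := (Num.sqrt s * (1 + Num.sqrt s) ^+ 2)^-1.

Lemma phi_ge0 s : 0 <= phi s.
Proof. by rewrite invr_ge0 mulr_ge0 ?sqrtr_ge0// sqr_ge0. Qed.

(** [D = 1 + 24 kappa] closes the Duhamel balance: the initial datum contributes [4 phi + 1], the
    source produced by [4 phi] at most [24 kappa], and the exponential term [D (exp (kappa t) - 1)].
    The constants add up to [D]. *)
Definition barrier_growth s := 4 * phi s + (1 + 24 * kappa) * expR (kappa * s).

Definition barrier_coef s := expR (- (zeta * s)) * barrier_growth s.

Definition barrier s y := clamp (barrier_coef s * spow w y).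

Lemma barrier_coef_ge0 s : 0 <= barrier_coef s.
Proof.
rewrite mulr_ge0 ?expR_ge0// addr_ge0//; first by rewrite mulr_ge0 ?phi_ge0.
by rewrite mulr_ge0 ?expR_ge0// addr_ge0// mulr_ge0// ltW// kappa_gt0.
Qed.

Lemma measurable_phi : measurable_fun [set: R] phi.
Proof.
have -> : phi = fun s : R => (Num.sqrt s * (1 + Num.sqrt s) ^+ 2) `^ (-1).
  by apply/funext => s; rewrite powR_inv1// mulr_ge0 ?sqrtr_ge0// sqr_ge0.
apply: (measurableT_comp (measurable_powR (-1))).
have ms : measurable_fun [set: R] (@Num.sqrt R).
  by apply: continuous_measurable_fun; exact: sqrt_continuous.
by apply: measurable_funM => //; apply: measurable_funX; exact: measurable_funD.
Qed.

Lemma measurable_barrier_coef : measurable_fun [set: R] barrier_coef.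
Proof.
apply: measurable_funM.
  by apply: measurableT_comp => //=; apply: measurable_funN; exact: measurable_funM.
apply: measurable_funD.
  by apply: measurable_funM => //; exact: measurable_phi.
by apply: measurable_funM => //; apply: measurableT_comp => //=; exact: measurable_funM.
Qed.

Lemma barrier_jbm : jointly_bounded_measurable barrier.
Proof.
split; last by exists 1 => s y; exact: norm_clamp_le1.
have mc := @measurable_clamp R.
apply: (measurableT_comp mc); apply: measurable_funM.
  by apply: (measurableT_comp measurable_barrier_coef); exact: measurable_fst.
by apply: (measurableT_comp (measurable_spow w)); exact: measurable_snd.
Qed.

Lemma barrier_odd s y : barrier s (- y) = - barrier s y.
Proof. by rewrite /barrier spow_odd mulrN clampN. Qed.

Lemma barrier_ge0 s y : 0 <= y -> 0 <= barrier s y.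
Proof.
move=> y0; have : 0 <= barrier_coef s * spow w y.
  by rewrite mulr_ge0 ?barrier_coef_ge0// spow_ge0.
by move=> /clamp_le/andP[].
Qed.

(** As the left side lies in [[0, 1]], it is at most its power [w], hence at most
    [x ^ w t ^ (-w/2)]. For [t >= 1] the last factor is at most 1; for [t < 1] it is at most
    [t ^ (-1/2) <= 4 phi t], since [(1 + sqrt t) ^ 2 <= 4]. *)
Lemma heat_sg_le_spow t x : 0 < t -> 0 <= x ->
  heat t (@Num.sg R) x <= spow w x * (4 * phi t + 1).
Proof.
move=> t0 x0; have /andP[h0 h1] := heat_sg_ge0_le1 (ltW t0) x0.
have hx := heat_sg_le t0 x0.
set h := heat _ _ _ in h0 h1 hx *.
have st : 0 < Num.sqrt t by rewrite sqrtr_gt0.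
apply: (@le_trans _ _ ((x / Num.sqrt t) `^ w)).
  apply: (@le_trans _ _ (h `^ w)).
    move: h0; rewrite le_eqVlt => /predU1P[<-|hp]; first exact: powR_ge0.
    by rewrite ger1_powR// hp.
  by apply: ge0_ler_powR; rewrite ?nnegrE// ?(ltW w0)//; exact: le_trans hx.
rewrite powRM ?invr_ge0 ?(ltW st)// spowE// ler_wpM2l ?powR_ge0//.
have [t1|t1] := leP 1 t.
  rewrite -[leLHS]add0r lerD ?mulr_ge0 ?phi_ge0//.
  have -> : 1 = 1 `^ w :> R by rewrite powR1.
  apply: ge0_ler_powR; rewrite ?nnegrE ?invr_ge0 ?(ltW st) ?(ltW w0)//.
  by rewrite invf_le1// -[leLHS]sqrtr1 ler_wsqrtr.
have s1 : Num.sqrt t <= 1 by rewrite -[leRHS]sqrtr1 ler_wsqrtr// ltW.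
rewrite -[leLHS]addr0 lerD//.
apply: (@le_trans _ _ (Num.sqrt t)^-1).
  by apply: ler1_powR => //; rewrite -invr1 lef_pV2 ?posrE.
rewrite /phi invfM mulrCA ler_pMr ?invr_gt0// ler_pdivlMr ?mul1r; last first.
  by rewrite exprn_gt0// addr_gt0.
by have := sqrtr_ge0 t; nra.
Qed.

(* Near zero [phi] is unbounded, but it is controlled by its translate by [e],
   whose antiderivative [- 2 / (1 + sqrt (s + e))] is bounded. *)
Lemma phi_shift s e : 0 < e -> e <= s -> 4 * phi s <= 12 * phi (s + e).
Proof.
move=> e0 es; have s0 : 0 < s by lra.
set a := Num.sqrt s; set b := Num.sqrt (s + e).
have a0 : 0 < a by rewrite sqrtr_gt0.
have b0 : 0 < b by rewrite sqrtr_gt0 addr_gt0.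
have aa : a ^+ 2 = s by rewrite sqr_sqrtr// ltW.
have bb : b ^+ 2 = s + e by rewrite sqr_sqrtr// ltW// addr_gt0.
(* [71 / 50] slightly exceeds [sqrt 2], as allowed by [s + e <= 2 s]; its double stays below
   [3 = 12 / 4]. *)
have b32 : b <= 71 / 50 * a by nra.
rewrite /phi -/a -/b.
have pa : 0 < a * (1 + a) ^+ 2 by rewrite mulr_gt0// exprn_gt0// addr_gt0.
have pb : 0 < b * (1 + b) ^+ 2 by rewrite mulr_gt0// exprn_gt0// addr_gt0.
rewrite ler_pdivrMr// mulrAC ler_pdivlMr//.
have h2 : (1 + b) ^+ 2 <= 2 * (1 + a) ^+ 2 by nra.
have := ler_pM (ltW b0) (sqr_ge0 (1 + b)) b32 h2.
have h3 : 0 <= a * (1 + a) ^+ 2 by rewrite ltW.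
by move: h3; set q := a * (1 + a) ^+ 2; rewrite mulrACA -/q => h3 h4; lra.
Qed.

Lemma is_derive_phi s : 0 < s ->
  is_derive s (1 : R) (fun s => - 2 / (1 + Num.sqrt s)) (phi s).
Proof.
move=> s0; have a0 : 0 < Num.sqrt s by rewrite sqrtr_gt0.
have n0 : 1 + Num.sqrt s != 0 by rewrite gt_eqF// addr_gt0.
have ds := is_derive1_sqrt s0.
have d1 : is_derive s (1 : R) (fun s => 1 + Num.sqrt s) (2 * Num.sqrt s)^-1.
  by have := is_deriveD (is_derive_cst (1 : R) s (1 : R)) ds; rewrite add0r.
have d2 := @is_deriveV R (fun s => 1 + Num.sqrt s) s _ _ n0 d1.
apply: is_derive_eq; rewrite /phi /GRing.scale/= .
by field; rewrite n0 gt_eqF.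
Qed.

(** On the half line the inner truncation may be dropped, which leaves one truncated multiple of
    [spow]; rescaling by [gamma^-1] produces the factor [gamma ^ (- w)]. *)
Lemma heat_source_barrier_le r s x : 0 <= r -> 0 <= x ->
  heat r (source gamma (fun v => clamp (Y * v)) barrier s) x <=
  Y * barrier_coef s * gamma `^ (- w) * spow w x.
Proof.
move=> r0 x0; set b := Y * barrier_coef s * gamma `^ (- w).
have gam : 0 < gamma^-1 by rewrite invr_gt0; have := gamma1; lra.
have b0 : 0 <= b by rewrite mulr_ge0 ?powR_ge0// mulr_ge0 ?barrier_coef_ge0// ltW.
have hc : {homo (fun v => clamp (Y * v)) : a b / a <= b}.
  by move=> a c ac; apply: le_clamp; rewrite ler_pM2l.
have js := source_jbm gamma hc (fun v => norm_clamp_le1 (Y * v)) barrier_jbm.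
have E y : b * spow w y = Y * (barrier_coef s * spow w (gamma^-1 * y)).
  have -> : spow w (gamma^-1 * y) = gamma `^ (- w) * spow w y.
    rewrite spowM ?(ltW gam)//; congr (_ * _).
    have g0 : 0 <= gamma by have := gamma1; lra.
    by rewrite -(powR_inv1 g0) -powRrM mulN1r.
  by rewrite /b; ring.
have := heat_half_line_cst r0 x0 (lexx 0) (jbm_section s js) (bmf_clamp_spow w b).
rewrite addr0 => H; apply: le_trans (H _ _ _) (heat_clamp_spow_le w0 w1 r0 b0 x0).
- apply: source_odd => [v|y]; first by rewrite mulrN clampN.
  exact: barrier_odd.
- by move=> y; rewrite spow_odd mulrN clampN.
- move=> y y0; rewrite addr0 /source; rewrite E; apply: le_clamp; rewrite ler_pM2l// /barrier.
  have : 0 <= barrier_coef s * spow w (gamma^-1 * y).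
    by rewrite mulr_ge0 ?barrier_coef_ge0// spow_ge0// mulr_ge0// ltW.
  by move=> /clamp_le/andP[].
Qed.

Lemma barrier_super t x : 0 < t -> 0 <= x ->
  duhamel zeta gamma (fun v => clamp (Y * v)) barrier t x <= barrier t x.
Proof.
move=> t0 x0; have k0 := kappa_gt0.
have hc : {homo (fun v => clamp (Y * v)) : a b / a <= b}.
  by move=> a c ac; apply: le_clamp; rewrite ler_pM2l.
have js := source_jbm gamma hc (fun v => norm_clamp_le1 (Y * v)) barrier_jbm.
set S := source _ _ _ in js.
have hS1 r s : 0 <= r -> heat r (S s) x <= 1.
  move=> r0; have := @norm_heat_le R S x r 1 s r0 js (fun s y => norm_clamp_le1 _).
  by rewrite ler_norml => /andP[].
have iS : mu.-integrable `[0, t] (EFin \o (fun s => killed_heat zeta (t - s) (S s) x)).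
  apply: (@integrable_killedM _ _ _ _ 1); first exact: ltW.
    exact: measurable_heat_section.
  move=> s /andP[s0 st]; apply: norm_heat_le => //; first by rewrite subr_ge0.
  by move=> *; exact: norm_clamp_le1.
have /andP[g0 g1] := heat_sg_ge0_le1 (ltW t0) x0.
have p0 := spow_ge0 w0 x0.
have c0 := barrier_coef_ge0 t.
(* The barrier is a truncation, so both bounds are needed. The first holds because the weights
   [exp (- zeta t)] and [zeta exp (- zeta (t - s))] have total mass 1. *)
suff [d1 d2] : duhamel zeta gamma (fun v => clamp (Y * v)) barrier t x <= 1 /\
    duhamel zeta gamma (fun v => clamp (Y * v)) barrier t x <= barrier_coef t * spow w x.
  rewrite /barrier; case: (clampP (barrier_coef t * spow w x)) => -[+ ->] //.
  by have := mulr_ge0 c0 p0; lra.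
have kE : killed_heat zeta t (@Num.sg R) x = expR (- (zeta * t)) * heat t (@Num.sg R) x by [].
rewrite /duhamel kE -/S; split.
  have H : \int[mu]_(s in `[0, t]) killed_heat zeta (t - s) (S s) x <=
      zeta^-1 * expR (zeta * t - zeta * t) - zeta^-1 * expR (zeta * 0 - zeta * t).
    apply: (@Rintegral_le_FTC _ (fun s => zeta^-1 * expR (zeta * s - zeta * t)) (fun s => expR (zeta * s - zeta * t))) => //.
    - exact: ltW.
    - move=> s /andP[s0 st]; rewrite /killed_heat.
      have -> : - (zeta * (t - s)) = zeta * s - zeta * t by ring.
      by rewrite ler_piMr ?expR_ge0// hS1// subr_ge0 ltW.
    - move=> s _; apply: is_derive_eq; rewrite /GRing.scale/=; field.
      exact: lt0r_neq0.
    - apply: continuous_subspaceT => y; apply: continuous_comp; last exact: continuous_expR.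
      by apply: cvgB; [apply: cvgM; [exact: cvg_cst|exact: cvg_id]|exact: cvg_cst].
  rewrite subrr expR0 mulr0 sub0r in H.
  have e0 := expR_ge0 (- (zeta * t)).
  have h1 : expR (- (zeta * t)) * heat t (@Num.sg R) x <= expR (- (zeta * t)) by rewrite ler_piMr.
  have := ler_wpM2l (ltW z0) H; rewrite mulrBr mulr1 mulrA divff ?lt0r_neq0// mul1r.
  lra.
pose beta := spow w x * Y * gamma `^ (- w) * expR (- (zeta * t)).
have beta0 : 0 <= beta.
  by rewrite mulr_ge0 ?expR_ge0// mulr_ge0 ?powR_ge0// mulr_ge0// ltW.
pose D := 1 + 24 * kappa.
have D0 : 0 < D by rewrite addr_gt0// mulr_gt0.
(* For [s < e] the coefficient is too singular, so the source is bounded by 1 there; for [s >= e],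
   [phi_shift] applies. The parameter [e] is sent to 0 at the end. *)
have key e : 0 < e -> \int[mu]_(s in `[0, t]) killed_heat zeta (t - s) (S s) x <=
    expR 1 * e + beta * (24 + D / kappa * (expR (kappa * t) - 1)).
  move=> e0.
  (* [exp (1 - s / e)] is a smooth majorant of the indicator of [[0, e]] with integral at most
     [e exp 1]; it gives a single continuous integrand for both ranges of [s]. *)
  pose H s := - e * expR (1 - e^-1 * s) + beta * (12 * (- 2 / (1 + Num.sqrt (s + e))) + D / kappa * expR (kappa * s)).
  pose H' s := expR (1 - e^-1 * s) + beta * (12 * phi (s + e) + D * expR (kappa * s)).
  have dH s : 0 <= s <= t -> is_derive s (1 : R) H (H' s).
    move=> /andP[s0 st].
    have se : 0 < s + e by lra.
    have d1 : is_derive s (1 : R) (fun s => - e * expR (1 - e^-1 * s)) (expR (1 - e^-1 * s)).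
      apply: is_derive_eq; rewrite /GRing.scale/=; field.
      exact: lt0r_neq0.
    have d2 : is_derive s (1 : R) (fun s => D / kappa * expR (kappa * s)) (D * expR (kappa * s)).
      apply: is_derive_eq; rewrite /GRing.scale/=; field.
      exact: lt0r_neq0.
    have d3' : is_derive s (1 : R) (fun s => s + e) 1.
      by apply: is_derive_eq; rewrite addr0.
    have d3 : is_derive s (1 : R) (fun s => - 2 / (1 + Num.sqrt (s + e))) (phi (s + e)).
      have := @is_derive1_comp R (fun s => - 2 / (1 + Num.sqrt s)) (fun s => s + e) s _ _ (is_derive_phi se) d3'.
      by rewrite mulr1.
    apply: is_derive_eq.
    by rewrite /H' /GRing.scale/=.
  have H0 : H t - H 0 <= expR 1 * e + beta * (24 + D / kappa * (expR (kappa * t) - 1)).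
    rewrite /H !mulr0 expR0 subr0.
    have q1 := expR_ge0 (1 - e^-1 * t).
    have se : 0 <= Num.sqrt (t + e) by exact: sqrtr_ge0.
    have se0 : 0 <= Num.sqrt (0 + e) by exact: sqrtr_ge0.
    have i1 : 0 <= 2 / (1 + Num.sqrt (t + e)) by rewrite divr_ge0// addr_ge0.
    have i2 : 2 / (1 + Num.sqrt (0 + e)) <= 2.
      by rewrite ler_pdivrMr; lra.
    have q2 : 0 <= e * expR (1 - e^-1 * t) by rewrite mulr_ge0// ltW.
    have q3 : beta * (12 * (2 / (1 + Num.sqrt (0 + e)) - 2 / (1 + Num.sqrt (t + e)))) <= beta * 24.
      by rewrite ler_wpM2l//; lra.
    by rewrite !mulNr; lra.
  apply: le_trans H0; apply: (@Rintegral_le_FTC _ H H') => //; first exact: ltW.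
  - move=> s /andP[s0 st]; rewrite /killed_heat /H'.
    have ts : 0 <= t - s by rewrite subr_ge0 ltW.
    have /andP[ez0 ez1] := expR_killed_le1 (ltW z0) (ltW st).
    have t1 : 0 <= beta * (12 * phi (s + e) + D * expR (kappa * s)).
      by rewrite mulr_ge0// addr_ge0// mulr_ge0 ?phi_ge0 ?expR_ge0// ltW.
    have t2 := expR_ge0 (1 - e^-1 * s).
    have [se|es] := ltP s e.
      have h1 : expR (- (zeta * (t - s))) * heat (t - s) (S s) x <= 1.
        by rewrite (le_trans _ ez1)// ler_piMr// hS1.
      have h2 : 1 <= expR (1 - e^-1 * s).
        by rewrite -[leLHS]expR0 ler_expR subr_ge0 mulrC ler_pdivrMr// mul1r ltW.
      lra.
    have h1 := heat_source_barrier_le s ts x0; rewrite -/S in h1.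
    have h2 := ler_wpM2l ez0 h1.
    have h3 := phi_shift e0 es.
    apply: (le_trans h2).
    have -> : expR (- (zeta * (t - s))) * (Y * barrier_coef s * gamma `^ (- w) * spow w x) =
      beta * (4 * phi s + D * expR (kappa * s)).
      rewrite /barrier_coef /barrier_growth /beta -/D.
      have -> : - (zeta * (t - s)) = - (zeta * t) + zeta * s by ring.
      rewrite expRD (expRN (zeta * s)); field.
      by rewrite gt_eqF// expR_gt0.
    rewrite -[leLHS]add0r lerD// ler_wpM2l// lerD2r//.
  - apply: continuous_in_subspaceT => s; rewrite inE/= in_itv/= => /andP[s0 st].
    have a0 : 0 < Num.sqrt (s + e) by rewrite sqrtr_gt0; lra.
    have cexp (a b : R) : {for s, continuous (fun s => expR (a + b * s))}.
      apply: continuous_comp; last exact: continuous_expR.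
      by apply: cvgD; [exact: cvg_cst|apply: cvgM; [exact: cvg_cst|exact: cvg_id]].
    have csq : {for s, continuous (fun s => Num.sqrt (s + e))}.
      apply: continuous_comp; last exact: sqrt_continuous.
      by apply: cvgD; [exact: cvg_id|exact: cvg_cst].
    have c1 : {for s, continuous (fun s : R => expR (1 - e^-1 * s))}.
      have -> : (fun s : R => expR (1 - e^-1 * s)) = (fun s => expR (1 + - e^-1 * s)).
        by apply/funext => r; rewrite mulNr.
      exact: cexp.
    have c2 : {for s, continuous (fun s : R => expR (kappa * s))}.
      have -> : (fun s : R => expR (kappa * s)) = (fun s => expR (0 + kappa * s)).
        by apply/funext => r; rewrite add0r.
      exact: cexp.
    have cD : {for s, continuous (fun s : R => 1 + Num.sqrt (s + e))}.
      by apply: cvgD => //; exact: cvg_cst.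
    have c3 : {for s, continuous (fun s : R => phi (s + e))}.
      apply: (@continuousV _ _ (fun s : R => Num.sqrt (s + e) * (1 + Num.sqrt (s + e)) ^+ 2) s).
        by rewrite gt_eqF// mulr_gt0// exprn_gt0// addr_gt0.
      by apply: cvgM => //; exact: (cvgM cD cD).
    apply: cvgD; first exact: c1.
    apply: cvgM; first exact: cvg_cst.
    apply: cvgD; last first.
      by apply: cvgM; [exact: cvg_cst|exact: c2].
    apply: cvgM; first exact: cvg_cst.
    exact: c3.
apply/ler_addgt0Pr => eps eps0.
have ze : 0 < zeta * expR 1 by rewrite mulr_gt0// expR_gt0.
have := ler_wpM2l (ltW z0) (key _ (divr_gt0 eps0 ze)).
have h0 := heat_sg_le_spow t0 x0.
have := ler_wpM2l (expR_ge0 (- (zeta * t))) h0.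
rewrite /barrier_coef /barrier_growth -/D.
have -> : zeta * (expR 1 * (eps / (zeta * expR 1)) + beta * (24 + D / kappa * (expR (kappa * t) - 1))) =
  eps + spow w x * expR (- (zeta * t)) * (24 * kappa + D * (expR (kappa * t) - 1)).
  have -> : beta = spow w x * kappa / zeta * expR (- (zeta * t)).
    by rewrite /beta /kappa; field; exact: lt0r_neq0.
  by field; rewrite !gt_eqF// expR_gt0.
set E := expR (- (zeta * t)); set K := expR (kappa * t).
set I := zeta * _; rewrite /D; lra.
Qed.

(** The restriction [t >= 1] in part (1) enters here: [4 phi t <= 1] once [sqrt t >= 1], so the
    exponential absorbs the jump correction. *)
Lemma barrier_coef_ge1 t : 1 <= t ->
  barrier_coef t <= (2 + 24 * kappa) * expR ((kappa - zeta) * t).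
Proof.
move=> t1; have k0 := kappa_gt0; have t0 : 0 < t by lra.
have s1 : 1 <= Num.sqrt t by rewrite -[leLHS]sqrtr1 ler_wsqrtr.
have -> : expR ((kappa - zeta) * t) = expR (- (zeta * t)) * expR (kappa * t).
  by rewrite -expRD; congr expR; ring.
rewrite /barrier_coef /barrier_growth [leRHS]mulrCA ler_wpM2l ?expR_ge0//.
have p1 : 4 * phi t <= 1.
  rewrite ler_pdivrMr; first by nra.
  by rewrite mulr_gt0 ?exprn_gt0 ?addr_gt0//; lra.
have : 1 <= expR (kappa * t) by rewrite -expR0 ler_expR mulr_ge0// ltW.
by lra.
Qed.

End upper_barrier.

(** * A bounded profile with slowly varying logarithmic slope *)

Section log_profile.
Context {R : realType} (k : R) (k0 : 0 < k).
Implicit Types (x y z a w : R).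

(* [psi z] is the minimum over slopes [w] in [0, 1] of
   [w z + (1 - w)^2 / (2 k)], attained at [slope z]. *)
Definition slope z : R := Num.max 0 (Num.min 1 (1 - k * z)).

Definition psi z := slope z * z + (1 - slope z) ^+ 2 / (2 * k).

Lemma slopeP z : [\/ [/\ 0 <= 1 - k * z, 1 - k * z <= 1 & slope z = 1 - k * z],
  1 <= 1 - k * z /\ slope z = 1 | 1 - k * z <= 0 /\ slope z = 0].
Proof.
rewrite /slope; have [h|h] := leP 1 (1 - k * z).
  by apply: Or32; rewrite max_r.
have [h'|h'] := leP 0 (1 - k * z); first by apply: Or31; split => //; exact: ltW.
by apply: Or33; split => //; exact: ltW.
Qed.

Lemma slope_itv z : 0 <= slope z <= 1.
Proof. by case: (slopeP z) => [[]|[]|[]]; lra. Qed.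

Lemma psi_le w z : 0 <= w <= 1 -> psi z <= w * z + (1 - w) ^+ 2 / (2 * k).
Proof.
move=> w01; rewrite /psi -subr_ge0.
set s := slope z.
have -> : w * z + (1 - w) ^+ 2 / (2 * k) - (s * z + (1 - s) ^+ 2 / (2 * k)) =
  ((w - s) * (2 * (k * z) - 2 + s + w)) / (2 * k).
  by field; exact: lt0r_neq0.
apply: divr_ge0; last by rewrite mulr_ge0// ltW.
have := slopeP z; rewrite -/s; move: s (k * z) w01 => s q /andP[wp wq].
case=> [[_ _ ->]|[h ->]|[h ->]].
- by have := sqr_ge0 (w - (1 - q)); rewrite expr2; lra.
- by nra.
- by nra.
Qed.

Lemma psi_nonpos z : z <= 0 -> psi z = z.
Proof.
move=> z0; have kz : k * z <= 0 by rewrite mulr_ge0_le0// ltW.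
have -> : psi z = z.
  rewrite /psi; case: (slopeP z) => [[_ h ->]|[_ ->]|[h _]]; last lra.
    have -> : k * z = 0 by lra.
    by rewrite !subr0 subrr expr0n/= mul0r addr0 mul1r.
  by rewrite subrr expr0n/= mul0r addr0 mul1r.
by [].
Qed.

(** The slope that is optimal at [z + a] is a competitor in the minimum defining [psi z]. *)
Lemma psi_shift z a : psi z + slope (z + a) * a <= psi (z + a).
Proof.
have := psi_le z (slope_itv (z + a)); rewrite {3}/psi; lra.
Qed.

Lemma psi_ub z : psi z <= (2 * k)^-1.
Proof.
by have := @psi_le 0 z; rewrite mul0r add0r subr0 expr1n mul1r; apply; rewrite lexx ler01.
Qed.

Lemma slope_lip z a : `|slope (z + a) - slope z| <= k * `|a|.
Proof.
rewrite ler_norml; have ka1 := ler_norm a; have ka2 := ler_norm (- a).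
rewrite normrN in ka2.
have h1 := ler_wpM2l (ltW k0) ka1; have h2 := ler_wpM2l (ltW k0) ka2.
have : k * (z + a) = k * z + k * a by ring.
have k3 : k * - a = - (k * a) by ring.
by case: (slopeP z) => [[? ? ->]|[? ->]|[? ->]];
  case: (slopeP (z + a)) => [[? ? ->]|[? ->]|[? ->]]; lra.
Qed.

(** Moves the slope from [z + a] to [z] at the cost [k a ^ 2]: up to this error the profile behaves
    near [exp z] like a power with exponent [slope z]. *)
Lemma psi_shift_slope z a : psi z + slope z * a - k * a ^+ 2 <= psi (z + a).
Proof.
apply: le_trans (psi_shift z a).
rewrite -addrA lerD2l.
have : `|(slope (z + a) - slope z) * a| <= k * a ^+ 2.
  by rewrite normrM -[a ^+ 2]real_normK ?num_real// expr2 mulrA ler_wpM2r// slope_lip.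
by rewrite ler_norml mulrBl => /andP[+ _]; lra.
Qed.

(** The odd function equal to [exp psi] in logarithmic coordinates: the identity on [[0, 1]], so
    without singularity at the origin, and constant far out. *)
Definition profile y := Num.sg y * expR (psi (ln `|y|)).

Lemma profile_odd y : profile (- y) = - profile y.
Proof. by rewrite /profile sgrN normrN mulNr. Qed.

Lemma profile0 : profile 0 = 0. Proof. by rewrite /profile sgr0 mul0r. Qed.

Lemma profileE y : 0 < y -> profile y = expR (psi (ln y)).
Proof. by move=> y0; rewrite /profile gtr0_sg// mul1r gtr0_norm. Qed.

Lemma profile_ge0 y : 0 <= y -> 0 <= profile y.
Proof. by move=> y0; rewrite mulr_ge0 ?sgr_ge0 ?expR_ge0. Qed.

Lemma profile_id y : 0 <= y <= 1 -> profile y = y.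
Proof.
move=> /andP[]; rewrite le_eqVlt => /predU1P[<- _|y0 y1]; first exact: profile0.
by rewrite profileE// psi_nonpos ?lnK// ln_le0.
Qed.

Lemma profile_norm_le y : `|profile y| <= expR (2 * k)^-1.
Proof.
rewrite /profile normrM [`|expR _|]ger0_norm ?expR_ge0//.
rewrite -[leRHS]mul1r ler_pM ?expR_ge0//; last by rewrite ler_expR psi_ub.
by rewrite normr_sg; case: (_ != 0).
Qed.

Lemma profile_mulr y a : 0 <= y ->
  profile y * expR (slope (ln y) * a - k * a ^+ 2) <= profile (expR a * y).
Proof.
rewrite le_eqVlt => /predU1P[<-|y0]; first by rewrite mulr0 profile0 mul0r.
rewrite !profileE ?mulr_gt0 ?expR_gt0// lnM ?posrE ?expR_gt0// expRK -expRD ler_expR.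
by rewrite addrC (addrC a); have := psi_shift_slope (ln y) a; lra.
Qed.

Lemma profile_homo x y : 0 <= x -> x <= y -> profile x <= profile y.
Proof.
rewrite le_eqVlt => /predU1P[<- y0|x0 xy]; first by rewrite profile0 profile_ge0.
have y0 : 0 < y by lra.
rewrite !profileE// ler_expR.
have lxy : 0 <= ln y - ln x by rewrite subr_ge0 ler_ln ?posrE.
have := psi_shift (ln x) (ln y - ln x).
have -> : ln x + (ln y - ln x) = ln y by ring.
have /andP[s0 s1] := slope_itv (ln y).
by have := mulr_ge0 s0 lxy; lra.
Qed.

(** Slopes at most 1 make [profile y / y] nonincreasing. *)
Lemma profile_ratio x y : 0 <= x -> x <= y -> 0 < y -> x / y * profile y <= profile x.
Proof.
rewrite le_eqVlt => /predU1P[<- _ y0|x0 xy y0]; first by rewrite profile0 !mul0r.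
rewrite !profileE//.
have -> : x / y = expR (ln x - ln y) by rewrite expRD expRN !lnK.
rewrite -expRD ler_expR.
have lxy : 0 <= ln y - ln x by rewrite subr_ge0 ler_ln ?posrE.
have := psi_shift (ln y) (ln x - ln y).
have -> : ln y + (ln x - ln y) = ln x by ring.
have /andP[s0 s1] := slope_itv (ln x).
have : slope (ln x) * (ln y - ln x) <= ln y - ln x by rewrite ler_piMl.
lra.
Qed.

(** The error is relative to [profile x], so that diffusion costs a factor even near the origin. For
    [z >= 1/2] the left side is nonpositive and the right side nonnegative; for smaller [z], either
    [x <= 1/2] and the profile is the identity throughout, or monotonicity and [profile_ratio]
    suffice. *)
Lemma profile_second_difference x z : 0 <= x ->
  2 * profile x - 4 * `|z| * profile x <= profile (x + z) + profile (x - z).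
Proof.
move=> x0; wlog z0 : z / 0 <= z.
  move=> H; have [z0|z0] := leP 0 z; first exact: H.
  have := H (- z); rewrite opprK normrN => H'.
  by rewrite [X in _ <= X]addrC; apply: H'; lra.
rewrite ger0_norm//; have p0 := profile_ge0 x0.
have [z2|z2] := leP (1/2) z.
  apply: (@le_trans _ _ 0); first by nra.
  have [zx|xz] := leP z x; first by rewrite addr_ge0// profile_ge0; lra.
  have -> : x - z = - (z - x) by ring.
  by rewrite profile_odd subr_ge0 profile_homo; lra.
have [x2|x2] := leP x (1/2).
  rewrite (@profile_id (x + z)) ?(@profile_id x); [|lra..].
  suff -> : profile (x - z) = x - z by nra.
  have [zx|xz] := leP z x; first by rewrite profile_id; lra.
  have -> : x - z = - (z - x) by ring.
  by rewrite profile_odd profile_id; lra.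
have xp : 0 < x by lra.
have h1 : profile x <= profile (x + z) by apply: profile_homo; lra.
have h2 : (x - z) / x * profile x <= profile (x - z) by apply: profile_ratio; lra.
have h3 : (x - z) / x * profile x = profile x - z / x * profile x.
  by field; exact: lt0r_neq0.
have h4 : z / x <= 4 * z by rewrite ler_pdivrMr//; nra.
by have := ler_wpM2r p0 h4; lra.
Qed.

Lemma measurable_profile : measurable_fun [set: R] profile.
Proof.
have mn : measurable_fun [set: R] (fun y : R => `|y|) by exact: normr_measurable.
have ml : measurable_fun [set: R] (fun y : R => ln `|y|).
  by apply: (measurableT_comp (@measurable_ln R)).
have ms : measurable_fun [set: R] slope.
  apply: measurable_maxr => //; apply: measurable_minr => //.
  by apply: measurable_funB => //; exact: measurable_funM.
have mp : measurable_fun [set: R] psi.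
  apply: measurable_funD; first exact: measurable_funM.
  by apply: measurable_funM => //; apply: measurable_funX; exact: measurable_funB.
apply: measurable_funM; first by have [] := @bmf_sg R.
apply: measurableT_comp => //; exact: (measurableT_comp mp ml).
Qed.

Lemma bmf_profile (b c : R) : bounded_measurable (fun y => b * profile (c * y)).
Proof.
apply: bmfZ; apply: bmf_scale; split; first exact: measurable_profile.
by exists (expR (2 * k)^-1) => y; exact: profile_norm_le.
Qed.

(** [2 |z| <= 1 + z ^ 2] turns the linear error into the quadratic one of [ge_heat_quadratic];
    stretching by [K] makes the relative loss small. *)
Lemma heat_profile_ge r x (K : R) : 0 <= r -> 0 <= x -> 0 < K ->
  profile (K^-1 * x) * (1 - (1 + 6 * r) / K) <= heat r (fun y => profile (K^-1 * y)) x.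
Proof.
move=> r0 x0 K0; set p := profile (K^-1 * x).
have Ki : 0 < K^-1 by rewrite invr_gt0.
have p0 : 0 <= p by apply: profile_ge0; rewrite mulr_ge0// ltW.
have bp : bounded_measurable (fun y => profile (K^-1 * y)).
  by have := bmf_profile 1 K^-1; under eq_fun do rewrite mul1r.
have := @ge_heat_quadratic R r (fun y => profile (K^-1 * y)) (p * (1 - K^-1)) (p / K) x r0.
have -> : p * (1 - K^-1) - 6 * r * (p / K) = p * (1 - (1 + 6 * r) / K) by ring.
apply => //; first by rewrite divr_ge0// ltW.
move=> z; have := @profile_second_difference (K^-1 * x) (K^-1 * z).
rewrite -/p -mulrDr -mulrBr => H.
have {}H := H (mulr_ge0 (ltW Ki) x0).
apply: le_trans H; rewrite normrM (gtr0_norm Ki).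
have h : 2 * `|z| <= 1 + z ^+ 2.
  by rewrite -[z ^+ 2]real_normK ?num_real//; have := sqr_ge0 (`|z| - 1); nra.
have := ler_wpM2l (mulr_ge0 (ltW Ki) p0) h; lra.
Qed.

End log_profile.

(** * The subsolution moving at speed [nu] *)

Section lower_barrier.
Context {R : realType} (zeta gamma nu f theta d1 : R).
Hypothesis z0 : 0 < zeta.
Hypothesis gamma1 : 1 < gamma.
Hypothesis nu0 : 0 <= nu.
Hypothesis f0 : 0 < f.
Hypothesis theta0 : 0 < theta.
Hypothesis speed : forall w, 0 <= w <= 1 ->
  zeta - nu * w + theta <= zeta * f * gamma `^ (- w).
Notation mu := (@lebesgue_measure R).
Context (F : R -> R).
Hypothesis F_odd : forall v, F (- v) = - F v.
Hypothesis F_homo : {homo F : a b / a <= b}.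
Hypothesis F_le1 : forall v, `|F v| <= 1.
Hypothesis d10 : 0 < d1.
Hypothesis F_ge : forall v, 0 <= v <= d1 -> f * v <= F v.
Implicit Types (t x s r y : R).

Lemma Rintegral_ge_FTC (g H H' : R -> R) (a t : R) : 0 <= a -> a <= t ->
  mu.-integrable `[0, t] (EFin \o g) ->
  (forall s, 0 <= s <= t -> 0 <= g s) ->
  (forall s, a < s < t -> H' s <= g s) ->
  (forall s, a <= s <= t -> is_derive s (1 : R) H (H' s)) ->
  {within `[a, t], continuous H'} ->
  H t - H a <= \int[mu]_(s in `[0, t]) g s.
Proof.
move=> a0 at_ ig g0 Hg dH cH.
have mI b c : measurable (`[b, c]%classic : set (measurableTypeR R)) by [].
have iat : mu.-integrable `[a, t] (EFin \o g).
  by apply: (integrableS (mI 0 t) _ _ ig) => //; apply: subset_itvr; rewrite bnd_simp.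
have := @Rintegral_itvB R g (BLeft 0) (BRight t) a ig.
rewrite !bnd_simp => /(_ a0 at_) E.
have i1 : 0 <= \int[mu]_(s in `[0, a]) g s.
  apply: Rintegral_ge0 => s /=; rewrite in_itv/= => /andP[s0 sa].
  by rewrite g0// s0 (le_trans sa).
have sub : `]a, t[%classic `<=` `[a, t]%classic by apply: subset_itv; rewrite bnd_simp.
have iH : mu.-integrable `[a, t] (EFin \o H').
  by apply: continuous_compact_integrable => //; exact: segment_compact.
have : \int[mu]_(s in `[a, t]) H' s <= \int[mu]_(s in `[a, t]) g s.
  rewrite !Rintegral_itv_oo_cc//; apply: le_Rintegral => //.
  - exact: (integrableS (mI a t) _ sub iH).
  - exact: (integrableS (mI a t) _ sub iat).
rewrite (Rintegral_FTC at_ dH cH) -[X in _ <= X -> _]Rintegral_itv_obnd_cbnd.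
  by rewrite -E => h; apply: (le_trans h); rewrite lerBlDr lerDl.
by apply: (integrableS (mI a t) _ _ iat) => //; apply: subset_itv; rewrite bnd_simp.
Qed.

(** [rmin] is the least branching rate [rho = zeta f gamma ^ (- w)], reached at [w = 1], and [th] is
    the margin cut down so that [rho - th >= rmin / 2]. Then [rho / (rho - th) >= 1 + q] is the
    gain, and [(1 + q) (1 - 3 c) = 1] allows three losses of a factor [1 - c]. *)
Let rmin := zeta * f / gamma.
Let th := Num.min theta (rmin / 2).
Let q := th / (zeta * f).
Let c := q / (3 * (1 + q)).

Let gam0 : 0 < gamma. Proof. by have := gamma1; lra. Qed.
Let zf0 : 0 < zeta * f. Proof. exact: mulr_gt0. Qed.
Let rmin0 : 0 < rmin. Proof. exact: divr_gt0. Qed.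
Let th0 : 0 < th. Proof. by rewrite lt_min theta0 divr_gt0. Qed.
Let th_theta : th <= theta. Proof. by rewrite ge_min lexx. Qed.
Let th_rmin : th <= rmin / 2. Proof. by rewrite ge_min lexx orbT. Qed.
Let q0 : 0 < q. Proof. exact: divr_gt0. Qed.
Let c0 : 0 < c. Proof. by rewrite divr_gt0// mulr_gt0// addr_gt0. Qed.
Let c1 : c < 1. Proof. by rewrite ltr_pdivrMr; have := q0; lra. Qed.
Let cq : 1 <= (1 + q) * (1 - c) ^+ 3.
Proof.
have h : (1 - c) ^+ 3 = 1 - 3 * c + c ^+ 2 * (3 - c) by ring.
have h2 : 0 <= c ^+ 2 * (3 - c) by rewrite mulr_ge0 ?sqr_ge0//; have := c1; lra.
have h3 : (1 + q) * (1 - 3 * c) = 1.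
  by rewrite /c; field; apply/eqP; have := q0; lra.
by rewrite h mulrDr h3 lerDl mulr_ge0//; have := q0; lra.
Qed.

(** Each constant limits one loss to [c]: the window [T] the discarded tail, [k] the variation of
    the slope over logarithmic displacements at most [A] (as [k A ^ 2 = c]), and [K] the diffusion
    during time [T] (as [(1 + 6 T) / K = c]). [M] bounds the profile; [d] keeps the barrier where
    [F v >= f v] and below the contribution of the unbranched particle up to time [T]. *)
Let T := c^-1 / (rmin / 2).
Let A := nu * T + ln gamma.
Let k := c / A ^+ 2.
Let K := (1 + 6 * T) / c.
Let M := expR (2 * k)^-1.
Let d := Num.min d1 (expR (- (zeta * T)) * (1 - c)) / M.

Let T0 : 0 < T. Proof. by rewrite !divr_gt0 ?invr_gt0. Qed.
Let lg0 : 0 < ln gamma. Proof. by rewrite ln_gt0. Qed.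
Let A0 : 0 < A. Proof. by rewrite ltr_wpDl// mulr_ge0// ltW. Qed.
Let k0 : 0 < k. Proof. by rewrite divr_gt0// exprn_gt0. Qed.
Let K0 : 0 < K. Proof. by rewrite divr_gt0// addr_gt0// mulr_gt0. Qed.
Let cK : c * K = 1 + 6 * T.
Proof. by rewrite /K mulrC divfK ?lt0r_neq0. Qed.
Let M0 : 0 < M. Proof. exact: expR_gt0. Qed.
Let m0 : 0 < Num.min d1 (expR (- (zeta * T)) * (1 - c)).
Proof. by rewrite lt_min d10 mulr_gt0 ?expR_gt0// subr_gt0. Qed.
Let d0 : 0 < d. Proof. exact: divr_gt0. Qed.
Let dM : d * M = Num.min d1 (expR (- (zeta * T)) * (1 - c)).
Proof. by rewrite divfK// lt0r_neq0. Qed.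

Lemma renewal_tail : expR (- (rmin / 2 * T)) <= c.
Proof.
have -> : rmin / 2 * T = c^-1 by rewrite /T; field; rewrite !lt0r_neq0.
rewrite expRN -[leRHS]invrK lef_pV2 ?posrE ?invr_gt0 ?expR_gt0//.
by have := expR_ge1Dx c^-1; lra.
Qed.

(** The last expression is the integral of [rho exp (- (rho - th) r)] over [[0, T]]; the infinite
    window would give at least [1 + q]. *)
Lemma renewal_integral w : 0 <= w <= 1 ->
  let rho := zeta * f * gamma `^ (- w) in
  0 < rho - th /\ (1 + q) * (1 - c) <= rho / (rho - th) * (1 - expR (- ((rho - th) * T))).
Proof.
move=> /andP[w0 w1] rho.
have r1 : rmin <= rho.
  rewrite /rmin /rho ler_wpM2l ?(ltW zf0)// powRN lef_pV2 ?posrE ?powR_gt0//.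
  by rewrite -[leRHS]powRr1 ?(ltW gam0)// ler_powR// ltW.
have r2 : rho <= zeta * f.
  rewrite /rho ler_piMr ?(ltW zf0)// powRN invf_le1 ?powR_gt0//.
  by rewrite -(powRr0 gamma) ler_powR// ltW.
have h1 := th_rmin; have h2 := rmin0; have h3 := th0.
have rt : 0 < rho - th by lra.
split => //; apply: ler_pM.
- by have := q0; lra.
- by have := c1; lra.
- have -> : rho / (rho - th) = 1 + th / (rho - th) by field; exact: lt0r_neq0.
  by rewrite lerD2l /q ler_wpM2l ?(ltW h3)// lef_pV2 ?posrE//; lra.
- rewrite lerD2l lerN2; apply: le_trans renewal_tail.
  by rewrite ler_expR lerN2 ler_wpM2r ?(ltW T0)//; lra.
Qed.

(** Here [r = t - s] and [a = nu r - ln gamma] is the logarithmic displacement from the moving frame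
    and the rescaling. Treating the profile as a power [w] yields [exp (w a)]: its part
    [gamma ^ (- w)] enters [rho], and the hypothesis [speed] bounds the decay rate [zeta - nu w] by
    [rho - th]. *)
Lemma renewal_pointwise Y r (rho := zeta * f * gamma `^ (- slope k (ln Y))) :
  0 <= Y -> 0 <= r <= T ->
  profile k Y * (1 - c) * rho * expR (- ((rho - th) * r)) <=
  zeta * (expR (- (zeta * r)) * (f * profile k (expR (nu * r - ln gamma) * Y))).
Proof.
move=> Y0 /andP[r0 rT]; set w := slope k (ln Y) in rho *.
have w01 : 0 <= w <= 1 := slope_itv k (ln Y).
set a := nu * r - ln gamma.
have p0 := profile_ge0 k Y0.
have h1 := profile_mulr k0 a Y0; rewrite -/w in h1.
have aA : a ^+ 2 <= A ^+ 2.
  have nr : 0 <= nu * r by rewrite mulr_ge0.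
  have nT : nu * r <= nu * T by rewrite ler_wpM2l.
  by have := lg0; rewrite /a /A; nra.
have e1 : 1 - c <= expR (- (k * a ^+ 2)).
  apply: le_trans (expR_ge1Dx _); rewrite lerD2l lerN2.
  apply: (@le_trans _ _ (k * A ^+ 2)); first by rewrite ler_wpM2l// ltW.
  by rewrite /k divfK// expf_neq0// lt0r_neq0.
have e2 : expR (- ((rho - th) * r)) <= expR (- ((zeta - nu * w) * r)).
  rewrite ler_expR lerN2 ler_wpM2r//.
  by have := speed w01; rewrite -/rho; have := th_theta; lra.
have gw : gamma `^ (- w) = expR (- (w * ln gamma)).
  by rewrite /powR gt_eqF// mulNr.
have -> : zeta * (expR (- (zeta * r)) * (f * profile k (expR a * Y))) =
    zeta * f * expR (- (zeta * r)) * profile k (expR a * Y) by ring.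
have rho0 : 0 <= rho by rewrite mulr_ge0 ?(ltW zf0)// powR_ge0.
apply: (@le_trans _ _ (profile k Y * expR (- (k * a ^+ 2)) * rho * expR (- ((zeta - nu * w) * r)))).
  have c1' : 0 <= 1 - c by rewrite subr_ge0 ltW.
  apply: ler_pM; rewrite ?expR_ge0//; first by rewrite mulr_ge0// mulr_ge0.
  by rewrite ler_wpM2r// ler_wpM2l.
apply: le_trans (ler_wpM2l _ h1); last by rewrite mulr_ge0 ?expR_ge0// ltW.
rewrite /rho gw expRD /a.
have -> : - ((zeta - nu * w) * r) = - (zeta * r) + w * (nu * r) by ring.
have -> : w * (nu * r - ln gamma) = w * (nu * r) - w * ln gamma by ring.
by rewrite !expRD le_eqVlt; apply/orP; left; apply/eqP; ring.
Qed.

Definition lower_barrier t y := d * profile k (expR (- (nu * t)) / K * y).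

Lemma lower_barrier_odd t y : lower_barrier t (- y) = - lower_barrier t y.
Proof. by rewrite /lower_barrier mulrN profile_odd mulrN. Qed.

Lemma lower_barrier_ge0 t y : 0 <= y -> 0 <= lower_barrier t y.
Proof.
move=> y0; rewrite mulr_ge0 ?(ltW d0)// profile_ge0// mulr_ge0// divr_ge0 ?expR_ge0//.
exact: ltW.
Qed.

Lemma lower_barrier_norm t y : `|lower_barrier t y| <= Num.min d1 (expR (- (zeta * T)) * (1 - c)).
Proof.
by rewrite normrM (gtr0_norm d0) -dM ler_wpM2l ?(ltW d0)// profile_norm_le.
Qed.

Lemma lower_barrier_le1 t y : lower_barrier t y <= 1.
Proof.
have := lower_barrier_norm t y; rewrite le_min => /andP[_].
have : expR (- (zeta * T)) * (1 - c) <= 1.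
  have e1 : expR (- (zeta * T)) <= 1 by rewrite -expR0 ler_expR oppr_le0 mulr_ge0 ?ltW.
  by have := expR_ge0 (- (zeta * T)); have := c0; have := c1; nra.
by have := ler_norm (lower_barrier t y); lra.
Qed.

Lemma lower_barrier_jbm : jointly_bounded_measurable lower_barrier.
Proof.
split; last by exists (Num.min d1 (expR (- (zeta * T)) * (1 - c))); exact: lower_barrier_norm.
apply: measurable_funM => //; apply: (measurableT_comp (measurable_profile k)).
apply: measurable_funM; last exact: measurable_snd.
apply: measurable_funM => //; apply: measurableT_comp => //=.
by apply: measurable_funN; apply: measurable_funM => //; exact: measurable_fst.
Qed.

Lemma heat_lower_barrier_ge r s x : 0 <= r -> r <= T -> 0 <= s -> 0 <= x ->
  lower_barrier s (gamma^-1 * x) * (1 - c) <=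
  heat r (fun y => lower_barrier s (gamma^-1 * y)) x.
Proof.
move=> r0 rT s0 x0.
have gV : 0 < gamma^-1 by rewrite invr_gt0.
(* The spatial scale of the rescaled barrier at time [s]; being at least [K], it loses at most a
   factor [1 - c] to diffusion. *)
set K' := gamma * expR (nu * s) * K.
have K'0 : 0 < K' by rewrite mulr_gt0// mulr_gt0// expR_gt0.
have KK' : K <= K'.
  rewrite ler_peMl ?(ltW K0)//.
  have : 1 <= expR (nu * s) by rewrite -expR0 ler_expR mulr_ge0.
  by have := gamma1; nra.
have E y : expR (- (nu * s)) / K * (gamma^-1 * y) = K'^-1 * y.
  by rewrite /K' expRN; field; rewrite !lt0r_neq0// expR_gt0.
have -> : (fun y => lower_barrier s (gamma^-1 * y)) = (fun y => d * profile k (K'^-1 * y)).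
  by apply/funext => y; rewrite /lower_barrier E.
rewrite /lower_barrier E heatZ//; last first.
  by have := bmf_profile k0 1 K'^-1; under eq_fun do rewrite mul1r.
rewrite -mulrA ler_wpM2l ?(ltW d0)//.
apply: le_trans (heat_profile_ge k0 r0 x0 K'0).
rewrite ler_wpM2l ?profile_ge0 ?mulr_ge0 ?invr_ge0 ?(ltW K'0)// lerD2l lerN2.
rewrite ler_pdivrMr//; apply: (@le_trans _ _ (c * K)); last by rewrite ler_wpM2l ?(ltW c0).
by rewrite cK lerD2l ler_wpM2l.
Qed.

Lemma lower_barrier_sub t x : 0 < t -> 0 <= x ->
  lower_barrier t x <= duhamel zeta gamma F lower_barrier t x.
Proof.
move=> t0 x0.
have gV : 0 <= gamma^-1 by rewrite invr_ge0 ltW.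
have F0 v : 0 <= v -> 0 <= F v.
  by have := F_odd 0; rewrite oppr0 => F00 v0; have := F_homo v0; lra.
have jS := source_jbm gamma F_homo F_le1 lower_barrier_jbm.
set S := source _ _ _ in jS.
have oS s y : S s (- y) = - S s y.
  by apply: source_odd => // ?; exact: lower_barrier_odd.
have bS s := jbm_section s jS.
have I0 s : 0 <= s <= t -> 0 <= killed_heat zeta (t - s) (S s) x.
  move=> /andP[s0 st]; rewrite mulr_ge0 ?expR_ge0//; apply: heat_odd_ge0 => //.
    by rewrite subr_ge0.
  by move=> y y0; apply: F0; apply: lower_barrier_ge0; rewrite mulr_ge0.
have iS : mu.-integrable `[0, t] (EFin \o (fun s => killed_heat zeta (t - s) (S s) x)).
  apply: (@integrable_killedM _ _ _ _ 1); first exact: ltW.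
    exact: measurable_heat_section.
  by move=> s /andP[s0 st]; apply: norm_heat_le; rewrite ?subr_ge0// => *; exact: F_le1.
have I0' : 0 <= \int[mu]_(s in `[0, t]) killed_heat zeta (t - s) (S s) x.
  by apply: Rintegral_ge0 => s /=; rewrite in_itv/=; exact: I0.
have G0 : 0 <= killed_heat zeta t (@Num.sg R) x.
  by rewrite mulr_ge0 ?expR_ge0//; have /andP[] := heat_sg_ge0_le1 (ltW t0) x0.
rewrite /duhamel -/S.
have c1' : 0 <= 1 - c by have := c1; lra.
have [tT|Tt] := leP t T.
  (* before time [T] the contribution of the unbranched particle suffices *)
  apply: (@le_trans _ _ (killed_heat zeta t (@Num.sg R) x)); last first.
    by rewrite lerDl mulr_ge0// ltW.
  have [m1 m2] : d * M <= d1 /\ d * M <= expR (- (zeta * T)) * (1 - c).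
    by rewrite dM; split; rewrite ge_min lexx ?orbT.
  have bP := bmf_profile k0 M^-1 K^-1.
  have h1 := @heat_half_line_cst R t x 0 _ _ (ltW t0) x0 (lexx 0) bP (@bmf_sg R).
  have {}h1 : heat t (fun y => M^-1 * profile k (K^-1 * y)) x <= heat t (@Num.sg R) x.
    rewrite addr0 in h1; apply: h1.
    - by move=> y; rewrite mulrN profile_odd mulrN.
    - by move=> y; rewrite sgrN.
    - move=> y; rewrite addr0 le_eqVlt => /predU1P[<-|y0].
        by rewrite mulr0 profile0 mulr0 sgr0.
      rewrite gtr0_sg// ler_pdivrMl// mulr1 (le_trans (ler_norm _))//.
      exact: profile_norm_le.
  rewrite heatZ ?(ltW t0)// in h1; last first.
    by have := bmf_profile k0 1 K^-1; under eq_fun do rewrite mul1r.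
  have h2 := heat_profile_ge k0 (ltW t0) x0 K0.
  set p := profile k (K^-1 * x) in h2 *.
  have p0 : 0 <= p by rewrite profile_ge0// mulr_ge0 ?invr_ge0// ltW.
  have h3 : lower_barrier t x <= d * p.
    rewrite ler_wpM2l ?(ltW d0)//; apply: profile_homo => //.
      by rewrite mulr_ge0// divr_ge0 ?expR_ge0// ltW.
    rewrite ler_wpM2r// ler_piMl ?invr_ge0 ?(ltW K0)//.
    by rewrite -expR0 ler_expR oppr_le0 mulr_ge0// ltW.
  have h4 : p * (1 - c) <= p * (1 - (1 + 6 * t) / K).
    by rewrite ler_wpM2l// lerD2l lerN2 ler_pdivrMr// cK lerD2l ler_wpM2l.
  apply: (le_trans h3); rewrite /killed_heat.
  have h5 : expR (- (zeta * T)) <= expR (- (zeta * t)).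
    by rewrite ler_expR lerN2 ler_wpM2l// ltW.
  have h6 : M^-1 * (p * (1 - c)) <= heat t (@Num.sg R) x.
    by apply: le_trans h1; rewrite ler_wpM2l ?invr_ge0 ?(ltW M0)//; exact: le_trans h2.
  apply: (@le_trans _ _ (expR (- (zeta * T)) * (M^-1 * (p * (1 - c))))); last first.
    by apply: ler_pM; rewrite ?expR_ge0// mulr_ge0 ?invr_ge0 ?(ltW M0)// mulr_ge0.
  have -> : expR (- (zeta * T)) * (M^-1 * (p * (1 - c))) = expR (- (zeta * T)) * (1 - c) / M * p by ring.
  by rewrite ler_wpM2r// ler_pdivlMr.
apply: (@le_trans _ _ (zeta * \int[mu]_(s in `[0, t]) killed_heat zeta (t - s) (S s) x)); last first.
  by rewrite lerDr.
(* The position in the moving frame at the final time; its slope fixes one rate [rho] for the whole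
   window [[t - T, t]]. *)
pose Y := expR (- (nu * t)) / K * x.
have Y0 : 0 <= Y by rewrite mulr_ge0// divr_ge0 ?expR_ge0// ltW.
have [rt ri] := renewal_integral (slope_itv k (ln Y)).
set rho := zeta * f * _ in rt ri.
have rho0 : 0 <= rho by rewrite mulr_ge0 ?(ltW zf0)// powR_ge0.
(* Two factors [1 - c], for diffusion and for the slope; the third, for the tail, is in [ri]. *)
pose P := d * (profile k Y * (1 - c) ^+ 2).
have P0 : 0 <= P by rewrite mulr_ge0 ?(ltW d0)// mulr_ge0 ?profile_ge0// exprn_ge0.
pose H s := zeta^-1 * (P * (rho / (rho - th) * expR ((rho - th) * s - (rho - th) * t))).
pose H' s := zeta^-1 * (P * (rho * expR ((rho - th) * s - (rho - th) * t))).
have : H t - H (t - T) <= \int[mu]_(s in `[0, t]) killed_heat zeta (t - s) (S s) x.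
  apply: (@Rintegral_ge_FTC _ H H') => //.
  - by rewrite subr_ge0 ltW.
  - by rewrite lerBlDr lerDl ltW.
  - move=> s /andP[sT st].
    have s0 : 0 <= s by have := Tt; lra.
    have ts : 0 <= t - s <= T by lra.
    have /andP[ts0 tsT] := ts.
    have h1 := renewal_pointwise Y0 ts; rewrite -/rho in h1.
    have h2 := heat_lower_barrier_ge ts0 tsT s0 x0.
    have E : lower_barrier s (gamma^-1 * x) = d * profile k (expR (nu * (t - s) - ln gamma) * Y).
      rewrite /lower_barrier /Y; congr (_ * profile _ _).
      have -> : nu * (t - s) - ln gamma = nu * t + (- (nu * s) - ln gamma) by ring.
      rewrite !expRD (expRN (ln gamma)) lnK ?posrE// (expRN (nu * t)).
      by field; rewrite !lt0r_neq0// expR_gt0.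
    have j1 : jointly_bounded_measurable (fun s y => lower_barrier s (gamma^-1 * y)).
      by apply: jbm_comp; [exact: measurable_funM|exact: lower_barrier_jbm].
    have b1 := jbm_section s j1.
    have h3 : f * heat (t - s) (fun y => lower_barrier s (gamma^-1 * y)) x <= heat (t - s) (S s) x.
      rewrite -heatZ//.
      have := @heat_half_line_cst R (t - s) x 0 _ _ ts0 x0 (lexx 0) (bmfZ f b1) (bS s).
      rewrite addr0; apply => //.
        by move=> y; rewrite mulrN lower_barrier_odd mulrN.
      move=> y y0; rewrite addr0; apply: F_ge.
      have g0 : 0 <= gamma^-1 * y by rewrite mulr_ge0.
      rewrite lower_barrier_ge0//= (le_trans (ler_norm _))//.
      by have := lower_barrier_norm s (gamma^-1 * y); rewrite le_min => /andP[].
    rewrite /H' /killed_heat ler_pdivrMl//.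
    apply: (@le_trans _ _ (zeta * (expR (- (zeta * (t - s))) * (f * (lower_barrier s (gamma^-1 * x) * (1 - c)))))).
      rewrite E.
      have -> : zeta * (expR (- (zeta * (t - s))) * (f * (d * profile k (expR (nu * (t - s) - ln gamma) * Y) * (1 - c)))) =
        d * (1 - c) * (zeta * (expR (- (zeta * (t - s))) * (f * profile k (expR (nu * (t - s) - ln gamma) * Y)))) by ring.
      have -> : P * (rho * expR ((rho - th) * s - (rho - th) * t)) =
        d * (1 - c) * (profile k Y * (1 - c) * rho * expR (- ((rho - th) * (t - s)))).
        rewrite /P; have -> : - ((rho - th) * (t - s)) = (rho - th) * s - (rho - th) * t by ring.
        by ring.
      by rewrite ler_wpM2l// mulr_ge0// ltW.
    rewrite ler_wpM2l ?(ltW z0)// ler_wpM2l ?expR_ge0//; apply: le_trans h3.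
    by rewrite ler_wpM2l// ltW.
  - move=> s _; apply: is_derive_eq; rewrite /H' /GRing.scale/=; field.
    by rewrite !lt0r_neq0.
  - apply: continuous_subspaceT => s; do 3 (apply: cvgM; first exact: cvg_cst).
    apply: continuous_comp; last exact: continuous_expR.
    by apply: cvgB; [apply: cvgM; [exact: cvg_cst|exact: cvg_id]|exact: cvg_cst].
move=> /(ler_wpM2l (ltW z0)); apply: le_trans.
rewrite /H -mulrBr -mulrBr -mulrBr mulVKf ?lt0r_neq0// subrr expR0.
have -> : (rho - th) * (t - T) - (rho - th) * t = - ((rho - th) * T) by ring.
apply: le_trans (ler_wpM2l P0 ri).
rewrite /lower_barrier -/Y /P.
have -> : d * (profile k Y * (1 - c) ^+ 2) * ((1 + q) * (1 - c)) =
   d * (profile k Y * ((1 + q) * (1 - c) ^+ 3)) by ring.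
by rewrite ler_wpM2l ?(ltW d0)// ler_peMr ?profile_ge0.
Qed.

Lemma lower_barrier_pos : exists e Y, [/\ 0 < e, 0 < Y &
  forall t x, Y * expR (nu * t) <= x -> e <= lower_barrier t x].
Proof.
exists (d * profile k 1), K; split => //; first by rewrite mulr_gt0// profile_id// ler01 lexx.
move=> t x Kx; rewrite ler_wpM2l ?(ltW d0)//; apply: profile_homo => //.
rewrite mulrAC ler_pdivlMr// mul1r expRN mulrC ler_pdivlMr ?expR_gt0//.
Qed.

End lower_barrier.

(** * Raising the lower bound to a level [S] with [F S <= S] *)

Section bootstrap.
Context {R : realType} (zeta gamma nu : R) (z0 : 0 < zeta) (gamma1 : 1 < gamma)
  (nu0 : 0 <= nu).
Notation mu := (@lebesgue_measure R).
Context (F : R -> R) (L : R) (L0 : 0 < L).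
Hypothesis F_odd : forall v, F (- v) = - F v.
Hypothesis F_homo : {homo F : a b / a <= b}.
Hypothesis F_lip : forall a b c, 0 <= c -> a <= b + c -> F a <= F b + L * c.
Hypothesis F_le1 : forall v, `|F v| <= 1.
Context (u : R -> R -> R).
Hypothesis u_jbm : jointly_bounded_measurable u.
Hypothesis u_le1 : forall t x, `|u t x| <= 1.
Hypothesis u_odd : forall t x, 0 <= t -> u t (- x) = - u t x.
Hypothesis u_ge0 : forall t x, 0 <= t -> 0 <= x -> 0 <= u t x.
Hypothesis u_mild : forall t x, 0 <= t -> u t x = duhamel zeta gamma F u t x.
Implicit Types (t x y r s p q B l e : R).

(** A Chebyshev estimate: for [|z| > l] the quadratic [2 z ^ 2 / l ^ 2] exceeds 2, which covers even
    the worst value [-1] of [g]. *)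
Lemma heat_ge_far g r x p B l : 0 <= r -> 0 <= p <= 1 -> 0 < l ->
  bounded_measurable g -> (forall y, `|g y| <= 1) ->
  (forall y, B <= y -> p <= g y) -> B + l <= x ->
  p - 12 * r / l ^+ 2 <= heat r g x.
Proof.
move=> r0 /andP[p0 p1] l0 bg g1 gp Blx.
have l2 : 0 < l ^+ 2 by rewrite exprn_gt0.
have := @ge_heat_quadratic R r g p (2 / l ^+ 2) x r0.
have -> : p - 6 * r * (2 / l ^+ 2) = p - 12 * r / l ^+ 2 by ring.
apply => //; first by rewrite divr_ge0// ltW.
move=> z; have g1' y := g1 y; have [zl|lz] := leP `|z| l.
  have := zl; rewrite ler_norml => /andP[z1 z2].
  have h1 : p <= g (x + z) by apply: gp; lra.
  have h2 : p <= g (x - z) by apply: gp; lra.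
  have : 0 <= 2 / l ^+ 2 * z ^+ 2 by rewrite mulr_ge0 ?sqr_ge0// divr_ge0// ltW.
  lra.
have h3 : 1 <= z ^+ 2 / l ^+ 2.
  rewrite ler_pdivlMr// mul1r -[z ^+ 2]real_normK ?num_real//.
  by rewrite lerXn2r ?nnegrE// ltW.
have := g1 (x + z); have := g1 (x - z); rewrite !ler_norml => /andP[h4 _] /andP[h5 _].
have -> : 2 / l ^+ 2 * z ^+ 2 = 2 * (z ^+ 2 / l ^+ 2) by ring.
lra.
Qed.

Definition eventually_ge q := exists2 Y, 0 < Y &
  forall t x, 0 <= t -> Y * expR (nu * t) <= x -> q <= u t x.

(** Far to the right both the initial datum and the source are at least [F q], and their weights in
    the mild equation add up to 1; only diffusion over a distance [l] loses something. The threshold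
    grows to [gamma Y + l] because the source is evaluated at [gamma^-1 y]. *)
Lemma eventually_ge_step q e : 0 <= q <= 1 -> 0 < e -> eventually_ge q ->
  eventually_ge (F q - e).
Proof.
move=> /andP[q0 q1] e0 [Y Y0 HY].
have F0 v : 0 <= v -> 0 <= F v.
  by have := F_odd 0; rewrite oppr0 => F00 v0; have := F_homo v0; lra.
have p01 : 0 <= F q <= 1 by rewrite F0//=; have := F_le1 q; rewrite ler_norml => /andP[].
(* With this [l] the loss [12 r / l ^ 2] is [e / 3] times [zeta r / 2], which half of the killing
   factor absorbs. The initial term then costs [e / 3] and the integral [2 e / 3]. *)
pose l := Num.sqrt (72 / (zeta * e)).
have ze : 0 < zeta * e by rewrite mulr_gt0.
have l0 : 0 < l by rewrite sqrtr_gt0 divr_gt0.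
have l2 : l ^+ 2 = 72 / (zeta * e) by rewrite sqr_sqrtr// divr_ge0// ltW.
have gam0 : 0 < gamma by exact: lt_trans gamma1.
have gY : 0 < gamma * Y by rewrite mulr_gt0.
have gV : 0 <= gamma^-1 by rewrite invr_ge0 ltW.
exists (gamma * Y + l); first exact: addr_gt0.
move=> t x t0 Yx.
have e1 : 1 <= expR (nu * t) by rewrite -expR0 ler_expR mulr_ge0.
have Bx : gamma * Y * expR (nu * t) + l <= x.
  by apply: le_trans Yx; rewrite mulrDl lerD2l ler_peMr// ltW.
have x0 : 0 <= x.
  by apply: le_trans Bx; rewrite addr_ge0 ?(ltW l0)// mulr_ge0 ?expR_ge0// ltW.
rewrite u_mild// /duhamel.
have jS := source_jbm gamma F_homo F_le1 u_jbm.
set S := source _ _ _ in jS *.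
have h1 : F q - 12 * t / l ^+ 2 <= heat t (@Num.sg R) x.
  apply: (heat_ge_far t0 p01 l0 (@bmf_sg R) _ _ Bx).
    by move=> y; rewrite normr_sg; case: (_ != 0).
  move=> y By; rewrite gtr0_sg; first by have /andP[] := p01.
  by apply: lt_le_trans By; rewrite mulr_gt0// expR_gt0.
have h2 s : 0 <= s -> s <= t -> F q - 12 * (t - s) / l ^+ 2 <= heat (t - s) (S s) x.
  move=> s0 st; apply: (heat_ge_far _ p01 l0 (jbm_section s jS) _ _ Bx).
  - by rewrite subr_ge0.
  - by move=> y; exact: F_le1.
  - move=> y By; apply: F_homo; apply: HY => //.
    rewrite ler_pdivlMl//.
    by apply: le_trans By; rewrite mulrA ler_wpM2l ?(ltW gY)// ler_expR ler_wpM2l.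
have bnd r : 0 <= r -> expR (- (zeta * r)) * (F q - 12 * r / l ^+ 2) >=
    F q * expR (- (zeta * r)) - zeta * (e / (3 * zeta)) * expR (- (zeta / 2 * r)).
  move=> r0; rewrite l2.
  have E : expR (- (zeta * r)) = expR (- (zeta / 2 * r)) * expR (- (zeta / 2 * r)).
    by rewrite -expRD; congr expR; field.
  have Er : zeta / 2 * r * expR (- (zeta / 2 * r)) <= 1.
    rewrite expRN ler_pdivrMr ?expR_gt0// mul1r.
    by have := expR_ge1Dx (zeta / 2 * r); lra.
  have -> : expR (- (zeta * r)) * (F q - 12 * r / (72 / (zeta * e))) =
    F q * expR (- (zeta * r)) - e / 3 * expR (- (zeta / 2 * r)) * (zeta / 2 * r * expR (- (zeta / 2 * r))).
    by rewrite E; field; rewrite !lt0r_neq0.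
  have -> : zeta * (e / (3 * zeta)) = e / 3 by field; exact: lt0r_neq0.
  by rewrite lerD2l lerN2 ler_piMr// mulr_ge0 ?expR_ge0// divr_ge0// ltW.
pose H s := zeta^-1 * (F q * expR (zeta * s - zeta * t)) - 2 * (e / (3 * zeta)) * expR (zeta / 2 * s - zeta / 2 * t).
pose H' s := F q * expR (zeta * s - zeta * t) - zeta * (e / (3 * zeta)) * expR (zeta / 2 * s - zeta / 2 * t).
have I : H t - H 0 <= \int[mu]_(s in `[0, t]) killed_heat zeta (t - s) (S s) x.
  apply: (@Rintegral_ge_FTC _ _ H H') => //.
  - apply: (@integrable_killedM _ _ _ _ 1); first exact: ltW.
      exact: measurable_heat_section.
    by move=> s /andP[s0 st]; apply: norm_heat_le; rewrite ?subr_ge0// => *; exact: F_le1.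
  - move=> s /andP[s0 st]; rewrite mulr_ge0 ?expR_ge0//; apply: heat_odd_ge0 => //.
    + by rewrite subr_ge0.
    + exact: jbm_section.
    + by apply: source_odd => // y; exact: u_odd.
    + by move=> y y0; apply: F0; apply: u_ge0 => //; rewrite mulr_ge0.
  - move=> s /andP[s0 st]; rewrite /H' /killed_heat.
    have ts : 0 <= t - s by rewrite subr_ge0 ltW.
    have := bnd _ ts.
    have -> : - (zeta * (t - s)) = zeta * s - zeta * t by ring.
    have -> : - (zeta / 2 * (t - s)) = zeta / 2 * s - zeta / 2 * t by ring.
    move=> /le_trans; apply; rewrite ler_wpM2l ?expR_ge0//.
    by apply: h2; rewrite ltW.
  - move=> s _; apply: is_derive_eq; rewrite /H' /GRing.scale/=; field.
    exact: lt0r_neq0.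
  - apply: continuous_subspaceT => s.
    have cE b c : {for s, continuous (fun s : R => expR (b * s - c))}.
      apply: continuous_comp; last exact: continuous_expR.
      by apply: cvgB; [apply: cvgM; [exact: cvg_cst|exact: cvg_id]|exact: cvg_cst].
    by apply: cvgB; apply: cvgM; [exact: cvg_cst|exact: cE|exact: cvg_cst|exact: cE].
have Hlow : zeta^-1 * (F q * (1 - expR (- (zeta * t)))) - 2 * (e / (3 * zeta)) <= H t - H 0.
  rewrite /H !mulr0 !sub0r !subrr expR0.
  have := expR_ge0 (- (zeta / 2 * t)); set E := expR (- (zeta / 2 * t)) => E0.
  have : 0 <= 2 * (e / (3 * zeta)) * E.
    by rewrite mulr_ge0// mulr_ge0// divr_ge0 ?mulr_ge0// ltW.
  lra.
have k1 : F q * expR (- (zeta * t)) - e / 3 <= killed_heat zeta t (@Num.sg R) x.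
  rewrite /killed_heat; apply: le_trans (ler_wpM2l (expR_ge0 _) h1).
  apply: le_trans (bnd _ t0).
  have -> : zeta * (e / (3 * zeta)) = e / 3 by field; exact: lt0r_neq0.
  rewrite lerD2l lerN2 ler_piMr//; first by rewrite divr_ge0// ltW.
  by rewrite -expR0 ler_expR oppr_le0 mulr_ge0// divr_ge0// ltW.
have := ler_wpM2l (ltW z0) (le_trans Hlow I).
rewrite mulrBr mulVKf ?lt0r_neq0//.
have -> : zeta * (2 * (e / (3 * zeta))) = 2 * (e / 3) by field; exact: lt0r_neq0.
set J := zeta * _; lra.
Qed.

(** [S] is the supremum of the levels that [u] eventually exceeds. [eventually_ge_step] sends such
    levels to almost their image under [F], so [F S <= S] by the Lipschitz bound. The supremum need
    not be attained, hence the [e]. *)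
Lemma eventually_ge_fixed q : 0 < q -> eventually_ge q ->
  exists S, [/\ 0 < S, S <= 1, F S <= S & forall e, 0 < e -> eventually_ge (S - e)].
Proof.
move=> q0 Hq; pose E := [set r | 0 <= r /\ eventually_ge r].
have Eub r : eventually_ge r -> r <= 1.
  move=> [Y Y0 HY]; have := HY 0 Y (lexx _); rewrite mulr0 expR0 mulr1 lexx.
  by move=> /(_ erefl) h; have := u_le1 0 Y; rewrite ler_norml => /andP[_]; exact: le_trans h.
have Eq : E q by split => //; exact: ltW.
have hub : has_ubound E by exists 1 => r [_]; exact: Eub.
have hs : has_sup E by split => //; exists q.
have qS : q <= sup E by exact: ub_le_sup.
have S1 : sup E <= 1 by apply: ge_sup; [exists q|move=> r [_]; exact: Eub].
have near e : 0 < e -> exists r, [/\ 0 <= r, r <= 1, eventually_ge r & sup E - e < r].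
  move=> e0; have [r [r0 Er] sr] := sup_adherent e0 hs.
  by exists r; split => //; exact: Eub.
exists (sup E); split => //.
- exact: lt_le_trans qS.
- apply/ler_addgt0Pr => e e0.
  have e2 : 0 < e / (2 * L) by rewrite divr_gt0// mulr_gt0.
  have [r [r0 r1 Er Sr]] := near _ e2.
  have FS : F (sup E) <= F r + L * (e / (2 * L)).
    by apply: F_lip; [exact: ltW|lra].
  have h : F r - e / 2 <= sup E.
    have [neg|pos] := leP (F r - e / 2) 0.
      by apply: (le_trans neg); apply: (le_trans _ qS); exact: ltW.
    apply: ub_le_sup => //; split; first exact: ltW.
    by apply: eventually_ge_step => //; [rewrite r0|rewrite divr_gt0].
  have LE : L * (e / (2 * L)) = e / 2 by field; exact: lt0r_neq0.
  by rewrite LE in FS; lra.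
- move=> e e0; have [r [_ _ [Y Y0 HY] Sr]] := near _ e0.
  by exists Y => // t x t0 Yx; apply: le_trans (HY t x t0 Yx); exact: ltW.
Qed.

(* The [1]-Lipschitz regularization of the infimum of [u] over each curve
   [x = y e^(nu t)] *)
Lemma lipschitz_minorant X : 0 <= X <= 1 ->
  (forall e, 0 < e -> eventually_ge (X - e)) ->
  exists v : R -> R,
    [/\ {within `[0, +oo[, continuous v}, v x @[x --> +oo] --> X
      & forall t x, 0 <= t -> 0 <= x -> v (x * expR (- (nu * t))) <= u t x].
Proof.
move=> /andP[X0 X1] HX.
(* Capping [u] at [X] bounds the regularization above by [X], through the point [t = 0], [x = y]. *)
pose E y := [set r | exists t x, [/\ 0 <= t, 0 <= x &
  r = Num.min X (u t x) + `|y - x * expR (- (nu * t))|]].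
have E0 y : lbound (E y) 0.
  move=> _ [t [x [t0 x0 ->]]]; rewrite addr_ge0// le_min X0/=; exact: u_ge0.
have Ene y : E y !=set0.
  by exists (Num.min X (u 0 0) + `|y - 0 * expR (- (nu * 0))|); exists 0, 0.
pose v y := inf (E y).
have vle y r : E y r -> v y <= r by move=> Er; apply: ge_inf => //; exists 0.
have vge y b : lbound (E y) b -> b <= v y by move=> Eb; apply: lb_le_inf.
have lip y y' : v y - `|y - y'| <= v y'.
  apply: vge => _ [t [x [t0 x0 ->]]].
  have : v y <= Num.min X (u t x) + `|y - x * expR (- (nu * t))|.
    by apply: vle; exists t, x.
  have := ler_distD y' y (x * expR (- (nu * t))); lra.
exists v; split.
- apply: continuous_subspaceT => y; apply/cvgrPdist_le => e e0; near=> y'.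
  have yy : `|y - y'| <= e.
    by near: y'; apply: cvgr_dist_le e0; exact: cvg_id.
  rewrite ler_norml; have := lip y y'; have := lip y' y; rewrite (distrC y' y); lra.
- apply/cvgrPdist_le => e e0; have [Y Y0 HY] := HX _ e0; near=> y.
  (* Curves to the left of [Y], where [u] is not controlled, are then at distance at least [1 >= X],
     so the penalty alone suffices. *)
  have yY : Y + 1 <= y by near: y; apply: nbhs_pinfty_ge; rewrite num_real.
  have y0 : 0 <= y by lra.
  have up : v y <= X.
    apply: (@le_trans _ _ (Num.min X (u 0 y) + `|y - y * expR (- (nu * 0))|)).
      by apply: vle; exists 0, y.
    by rewrite mulr0 oppr0 expR0 mulr1 subrr normr0 addr0 ge_min lexx.
  have low : X - e <= v y.
    apply: vge => _ [t [x [t0 x0 ->]]].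
    have [xY|Yx] := leP Y (x * expR (- (nu * t))).
      have : X - e <= u t x.
        by apply: HY => //; move: xY; rewrite expRN ler_pdivlMr ?expR_gt0.
      have := normr_ge0 (y - x * expR (- (nu * t))).
      have [_|_] := leP X (u t x); lra.
    have : 1 <= `|y - x * expR (- (nu * t))| by rewrite (le_trans _ (ler_norm _))//; lra.
    have := u_ge0 t0 x0; have [_|_] := leP X (u t x); lra.
  by rewrite ler_norml; lra.
- move=> t x t0 x0.
  apply: (@le_trans _ _ (Num.min X (u t x) + `|x * expR (- (nu * t)) - x * expR (- (nu * t))|)).
    by apply: vle; exists t, x.
  by rewrite subrr normr0 addr0 ge_min lexx orbT.
Unshelve. all: by end_near. Qed.

End bootstrap.

(** * Monotonicity of binomial tails *)

Section binomial_tail.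
Context {R : realType}.
Implicit Types (a b c v : R).

(** For [a = 1 + v], [b = 1 - v] this is [2 ^ n] times the probability that at least [k] of [n]
    independent children vote 1, each with probability [(1 + v) / 2]. *)
Definition binomial_tail n k a b : R :=
  \sum_(k <= j < n.+1) 'C(n, j)%:R * a ^+ j * b ^+ (n - j).

Lemma binomial_tail0 n a b : binomial_tail n 0 a b = (a + b) ^+ n.
Proof.
rewrite /binomial_tail big_mkord exprDn_comm; last exact: mulrC.
rewrite (reindex_inj rev_ord_inj)/=; apply: eq_bigr => i _.
rewrite subSS subKn; last by rewrite -ltnS.
rewrite bin_sub; last by rewrite -ltnS.
by rewrite mulr_natl mulrnAl.
Qed.

Lemma binomial_tail_ge0 n k a b : 0 <= a -> 0 <= b -> 0 <= binomial_tail n k a b.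
Proof.
by move=> a0 b0; apply: sumr_ge0 => j _; rewrite !mulr_ge0 ?exprn_ge0.
Qed.

Lemma binomial_tail_leS n k a b : 0 <= a -> 0 <= b ->
  binomial_tail n k.+1 a b <= binomial_tail n k a b.
Proof.
move=> a0 b0; have [kn|nk] := leqP k n.
  by rewrite /binomial_tail [leRHS]big_ltn ?ltnS// lerDr !mulr_ge0 ?exprn_ge0.
by rewrite /binomial_tail !big_geq// leqW.
Qed.

Lemma binomial_tail_le0 n k a b : 0 <= a -> 0 <= b ->
  binomial_tail n k a b <= (a + b) ^+ n.
Proof.
move=> a0 b0; elim: k => [|k IH]; first by rewrite binomial_tail0.
exact: le_trans (binomial_tail_leS n k a0 b0) IH.
Qed.

(** Pascal's rule: condition on the vote of one child. *)
Lemma binomial_tailSS n k a b :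
  binomial_tail n.+1 k.+1 a b = a * binomial_tail n k a b + b * binomial_tail n k.+1 a b.
Proof.
rewrite /binomial_tail big_add1 /=.
under eq_bigr => i _ do rewrite binS natrD subSS 2!mulrDl.
rewrite big_split/= addrC; congr (_ + _).
  by rewrite mulr_sumr; apply: eq_bigr => i _; rewrite exprS; ring.
rewrite mulr_sumr.
transitivity (\sum_(k.+1 <= j < n.+2) 'C(n, j)%:R * a ^+ j * b ^+ (n.+1 - j)).
  by rewrite [RHS]big_add1/=; apply: eq_bigr => i _; rewrite subSS.
have [kn|nk] := leqP k n; last by rewrite !big_geq// leqW.
rewrite big_nat_recr//= bin_small// !mul0r addr0.
rewrite !big_nat; apply: eq_bigr => j /andP[_ jn].
by rewrite subSn// exprS; ring.
Qed.

(** In the recursion, moving the weight [c] from [b] to [a] adds [c] times the difference of the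
    tails at [k] and [k.+1], which is nonnegative. *)
Lemma binomial_tail_homo n k a b c : 0 <= a -> 0 <= c -> c <= b ->
  binomial_tail n k a b <= binomial_tail n k (a + c) (b - c).
Proof.
move=> a0 c0 cb; have b0 : 0 <= b by exact: le_trans cb.
have ac0 : 0 <= a + c by exact: addr_ge0.
have bc0 : 0 <= b - c by rewrite subr_ge0.
elim: n k => [|n IH] [|k].
- by rewrite !binomial_tail0.
- by rewrite /binomial_tail !big_geq.
- by rewrite !binomial_tail0; have -> : a + c + (b - c) = a + b by ring.
rewrite !binomial_tailSS.
have h1 := ler_wpM2l a0 (IH k); have h2 := ler_wpM2l b0 (IH k.+1).
have h3 := ler_wpM2l c0 (binomial_tail_leS n k ac0 bc0).
lra.
Qed.

End binomial_tail.

(** * Monotonicity and bounds for the voting function *)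

Section voting.
Context {R : realType} (p : nat -> R) (eta : nat -> nat -> R).
Hypothesis pP : is_offspring_law p.
Hypothesis etaP : is_threshold_law eta.
Implicit Types (v w : R).

Definition voting_term v n : R :=
  2 ^- n.-1 * p n * \sum_(1 <= k < n.+1) eta n k * binomial_tail n k (1 + v) (1 - v).

Lemma voting_funE v : voting_fun p eta v =
  lim ((fun N => \sum_(1 <= n < N) voting_term v n) @ \oo) - 1.
Proof. by []. Qed.

Lemma voting_term_ge0 v n : -1 <= v <= 1 -> (1 <= n)%N -> 0 <= voting_term v n.
Proof.
move=> /andP[v1 v2] n1; have [p0 _] := pP; have [e0 _] := etaP.
rewrite mulr_ge0//; first by rewrite mulr_ge0 ?p0// invr_ge0 exprn_ge0.
rewrite big_nat; apply: sumr_ge0 => k kn; rewrite mulr_ge0 ?e0//.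
by apply: binomial_tail_ge0; lra.
Qed.

Lemma voting_term_homo v w n : -1 <= v -> v <= w -> w <= 1 -> (1 <= n)%N ->
  voting_term v n <= voting_term w n.
Proof.
move=> v1 vw w1 n1; have [p0 _] := pP; have [e0 _] := etaP.
rewrite ler_wpM2l//; first by rewrite mulr_ge0 ?p0// invr_ge0 exprn_ge0.
rewrite !big_nat; apply: ler_sum => k kn; rewrite ler_wpM2l ?e0//.
have := @binomial_tail_homo R n k (1 + v) (1 - v) (w - v).
have -> : 1 + v + (w - v) = 1 + w by ring.
have -> : 1 - v - (w - v) = 1 - w by ring.
by apply; lra.
Qed.

Lemma voting_term_le v n : -1 <= v <= 1 -> (1 <= n)%N -> voting_term v n <= 2 * p n.
Proof.
move=> /andP[v1 v2] n1; have [p0 _] := pP; have [e0 e1] := etaP.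
rewrite /voting_term; apply: (@le_trans _ _ (2 ^- n.-1 * p n * 2 ^+ n)).
  rewrite ler_wpM2l//; first by rewrite mulr_ge0 ?p0// invr_ge0 exprn_ge0.
  have -> : 2 ^+ n = \sum_(1 <= k < n.+1) eta n k * 2 ^+ n :> R.
    by rewrite -mulr_suml e1// mul1r.
  rewrite !big_nat; apply: ler_sum => k kn.
  rewrite ler_wpM2l ?e0//.
  have := @binomial_tail_le0 R n k (1 + v) (1 - v).
  have -> : 1 + v + (1 - v) = 2 by ring.
  by apply; lra.
case: n n1 => // n _; rewrite /= exprS mulrAC.
have -> : 2 ^- n * (2 * 2 ^+ n) = 2 :> R by rewrite mulrCA mulVf ?mulr1// expf_neq0.
by [].
Qed.

Lemma offspring_sum_le1 N : \sum_(1 <= n < N) p n <= 1.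
Proof.
have [p0 p1] := pP.
have nd : nondecreasing_seq (fun N => \sum_(1 <= n < N) p n).
  apply/nondecreasing_seqP => n; case: n => [|n]; first by rewrite !big_geq.
  by rewrite [leRHS]big_nat_recr//= lerDl p0.
have := nondecreasing_cvgn_le nd (cvgP _ p1) N.
by rewrite (cvg_lim _ p1).
Qed.

Lemma voting_sum_le v N : -1 <= v <= 1 -> \sum_(1 <= n < N) voting_term v n <= 2.
Proof.
move=> v1; apply: (@le_trans _ _ (\sum_(1 <= n < N) 2 * p n)).
  by rewrite !big_nat; apply: ler_sum => n /andP[n1 _]; exact: voting_term_le.
rewrite -mulr_sumr; have := offspring_sum_le1 N; lra.
Qed.

Lemma voting_sum_cvg v : -1 <= v <= 1 ->
  cvgn (fun N => \sum_(1 <= n < N) voting_term v n).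
Proof.
move=> v1; apply: nondecreasing_is_cvgn.
  apply/nondecreasing_seqP => n; case: n => [|n]; first by rewrite !big_geq.
  by rewrite [leRHS]big_nat_recr//= lerDl voting_term_ge0.
by exists 2 => _ [N _ <-]; exact: voting_sum_le.
Qed.

Lemma voting_fun_homo v w : -1 <= v -> v <= w -> w <= 1 ->
  voting_fun p eta v <= voting_fun p eta w.
Proof.
move=> v1 vw w1; rewrite !voting_funE lerD2r.
apply: ler_lim; [apply: voting_sum_cvg; lra..|].
apply: nearW => N; rewrite !big_nat; apply: ler_sum => n /andP[n1 _].
exact: voting_term_homo.
Qed.

Lemma voting_fun_le1 v : -1 <= v <= 1 -> voting_fun p eta v <= 1.
Proof.
move=> v1; rewrite voting_funE lerBlDr.
apply: limr_le; first exact: voting_sum_cvg.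
by apply: nearW => N; have := voting_sum_le N v1; lra.
Qed.

End voting.

(** * One-sided derivatives and the Lipschitz constant of [F] *)

Section one_sided_derivative.
Context {R : realType}.
Implicit Types (f g : R -> R) (a b x y l e d : R) (A : set R).

Lemma is_derive_withinP A f x l : is_derive_within A f x l ->
  forall e, 0 < e -> exists2 d, 0 < d &
    forall y, A y -> y != x -> `|y - x| < d -> `|(f y - f x) / (y - x) - l| <= e.
Proof.
move=> /cvgrPdist_le H e e0; have := H e e0.
rewrite near_withinE /dnbhs near_withinE => /nbhs_ballP[d /= d0 Hd].
exists d => // y Ay yx yd; rewrite distrC; apply: Hd => //.
by rewrite /ball/= distrC.
Qed.

Lemma is_derive_eps f x l :
  (forall e, 0 < e -> exists2 d, 0 < d &
    forall y, y != x -> `|y - x| < d -> `|(f y - f x) / (y - x) - l| <= e) ->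
  is_derive x (1 : R) f l.
Proof.
move=> H.
have C : (h^-1 *: ((f \o shift x) (h *: (1 : R)) - f x)) @[h --> 0^'] --> l.
  apply/cvgrPdist_le => e e0; have [d d0 Hd] := H e e0.
  rewrite /dnbhs near_withinE; apply/nbhs_ballP; exists d => //= h.
  rewrite /ball/= sub0r normrN => hd h0.
  have := Hd (h + x); rewrite addrK -subr_eq0 addrK distrC => /(_ h0 hd).
  by rewrite /GRing.scale/= mulr1 mulrC.
by split; [apply: cvgP; exact: C|exact: (cvg_lim _ C)].
Qed.

Lemma is_derive_within_continuous f f1 a b :
  (forall x, a <= x <= b -> is_derive_within `[a, b] f x (f1 x)) ->
  {within `[a, b], continuous f}.
Proof.
move=> df; apply/subspace_continuousP => x; rewrite /= in_itv/= => xab.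
apply/cvgrPdist_le => e e0.
have [d d0 Hd] := is_derive_withinP (df x xab) (ltr01).
pose M := `|f1 x| + 1; have M0 : 0 < M by rewrite ltr_wpDl.
rewrite near_withinE; apply/nbhs_ballP; exists (Num.min d (e / M)) => /=.
  by rewrite lt_min d0 divr_gt0.
move=> y; rewrite /ball/= lt_min => /andP[yd ye] yab.
have [->|yx] := eqVneq y x; first by rewrite subrr normr0 ltW.
rewrite distrC in yd; have h := Hd y yab yx yd.
have q : `|(f y - f x) / (y - x)| <= M.
  have := ler_normD ((f y - f x) / (y - x) - f1 x) (f1 x); rewrite subrK /M; lra.
have yx0 : 0 < `|y - x| by rewrite normr_gt0 subr_eq0.
rewrite distrC -[f y - f x](@divfK _ (y - x)) ?subr_eq0// normrM.
apply: (@le_trans _ _ (M * (e / M))); last by rewrite mulrC divfK// lt0r_neq0.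
by apply: ler_pM => //; rewrite distrC ltW.
Qed.

Lemma is_derive_within_interior f a b x l : a < x < b ->
  is_derive_within `[a, b] f x l -> is_derive x (1 : R) f l.
Proof.
move=> /andP[ax xb] df; apply: is_derive_eps => e e0.
have [d d0 Hd] := is_derive_withinP df e0.
exists (Num.min d (Num.min (x - a) (b - x))).
  by rewrite !lt_min d0 !subr_gt0 ax xb.
move=> y yx; rewrite !lt_min => /and3P[yd ya yb]; apply: Hd => //.
rewrite /= in_itv/=; have := ler_norm (y - x); have := ler_norm (x - y).
by rewrite (distrC x y); lra.
Qed.

(** The first derivative is continuous, having itself a derivative, so it has a maximum on [[0, 1]].
    An upper bound on increments is enough, as [F] is monotone. *)
Lemma C2_lipschitz f : C2_on `[0, 1] f -> exists2 L, 0 < L &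
  forall a b, 0 <= a -> a <= b -> b <= 1 -> f b - f a <= L * (b - a).
Proof.
move=> [f1 [f2 [df1 df2 _]]].
have {}df1 x : 0 <= x <= 1 -> is_derive_within `[0, 1] f x (f1 x).
  by move=> x01; apply: df1; rewrite /= in_itv.
have {}df2 x : 0 <= x <= 1 -> is_derive_within `[0, 1] f1 x (f2 x).
  by move=> x01; apply: df2; rewrite /= in_itv.
have cf := is_derive_within_continuous df1.
have [c _ cmax] := EVT_max ler01 (is_derive_within_continuous df2).
exists (Num.max 1 (f1 c)); first by rewrite lt_max ltr01.
move=> a b a0 ab b1.
have sub : (`[a, b]%classic : set R) `<=` `[0, 1]%classic.
  by move=> z /=; rewrite !in_itv/= => /andP[za zb]; lra.
have df x : x \in `]a, b[ -> is_derive x (1 : R) f (f1 x).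
  rewrite in_itv/= => /andP[ax xb].
  by apply: (@is_derive_within_interior _ 0 1); [lra|apply: df1; lra].
have [z zab ->] := MVT_segment ab df (continuous_subspaceW sub cf).
rewrite ler_wpM2r ?subr_ge0// le_max; apply/orP; right; apply: cmax.
by move: zab; rewrite !in_itv/=; lra.
Qed.

(** [derive1] is two-sided while [C2_on] gives the derivative from the right at 0; oddness supplies
    the left side. *)
Lemma odd_derive1_0 f l : odd_on_unit f -> is_derive_within `[0, 1] f 0 l ->
  derive1 f 0 = l.
Proof.
move=> of_ df; rewrite derive1E; suff H : is_derive 0 (1 : R) f l by exact: derive_val.
have f0 : f 0 = 0.
  have := of_ 0; rewrite oppr0 in_itv/= => h; have : f 0 = - f 0 by apply: h; lra.
  lra.
apply: is_derive_eps => e e0; have [d d0 Hd] := is_derive_withinP df e0.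
exists (Num.min d 1); first by rewrite lt_min d0 ltr01.
move=> y y0; rewrite subr0 lt_min => /andP[yd y1].
have [yp|yn] := leP 0 y.
  rewrite ger0_norm// in yd y1.
  by have := Hd y; rewrite subr0 ger0_norm//; apply => //; rewrite /= in_itv/=; lra.
rewrite ltr0_norm// in yd y1.
have := Hd (- y); rewrite /= in_itv/= subr0 normrN ltr0_norm// oppr_eq0 of_; last first.
  by rewrite in_itv/=; lra.
rewrite f0 !subr0 invrN mulrNN; apply => //; lra.
Qed.

Lemma derivative_slope_lb f l m : is_derive_within `[0, 1] f 0 l -> f 0 = 0 -> m < l ->
  exists2 d, 0 < d <= 1 & forall v, 0 <= v <= d -> m * v <= f v.
Proof.
move=> df f0 ml; have lm : 0 < l - m by rewrite subr_gt0.
have [d d0 Hd] := is_derive_withinP df lm.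
exists (Num.min (d / 2) 1).
  by rewrite lt_min ltr01 divr_gt0//= ge_min lexx orbT.
move=> v; rewrite le_min => /and3P[v0 vd v1].
move: v0; rewrite le_eqVlt => /predU1P[<-|v0]; first by rewrite f0 mulr0.
have vI : `[0, 1]%classic v by rewrite /= in_itv/=; lra.
have := Hd v vI; rewrite f0 !subr0 gtr0_norm// gt_eqF// => H.
have {H} : `|f v / v - l| <= l - m by apply: H => //; lra.
rewrite ler_norml => /andP[h _].
by rewrite -ler_pdivlMr//; lra.
Qed.

End one_sided_derivative.

(** * The supremum [Sigma] and the choice of slopes *)

Section sigma.
Context {R : realType} (gamma : R) (gamma1 : 1 < gamma).
Implicit Types (f w : R).

Let rate f w := (1 - f * gamma `^ (- w)) / w.

Lemma powR_expR w : gamma `^ (- w) = expR (- (w * ln gamma)).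
Proof. by rewrite /powR gt_eqF ?mulNr//; exact: lt_trans gamma1. Qed.

Lemma powR_bounds w : 0 <= w -> 1 - w * ln gamma <= gamma `^ (- w) <= 1.
Proof.
move=> w0; rewrite powR_expR expR_ge1Dx/= -expR0 ler_expR oppr_le0 mulr_ge0//.
by rewrite ln_ge0// ltW.
Qed.

Lemma Sigma_has_ubound f : 1 <= f ->
  has_ubound [set (1 - f * gamma `^ (- w)) / w | w in `]0, 1]].
Proof.
move=> f1; exists (ln gamma) => r [w /=]; rewrite in_itv/= => /andP[w0 w1] <-.
have /andP[h1 h2] := powR_bounds (ltW w0).
rewrite ler_pdivrMr//; have := powR_ge0 gamma (- w); nra.
Qed.

Lemma Sigma_ge f w : 1 <= f -> 0 < w <= 1 -> rate f w <= Sigma f gamma.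
Proof.
move=> f1 w01; apply: ub_le_sup; first exact: Sigma_has_ubound.
by exists w => //=; rewrite in_itv/=.
Qed.

(** The interval [(0, 1]] is not compact, but the rate is nonpositive for [w <= ln f / ln gamma], so
    a positive supremum is a maximum over a compact interval. *)
Lemma Sigma_attained f : 1 < f -> 0 < Sigma f gamma ->
  exists2 w, 0 < w <= 1 & Sigma f gamma = (1 - f * gamma `^ (- w)) / w.
Proof.
move=> f1 S0; have lg : 0 < ln gamma by rewrite ln_gt0.
have lf : 0 < ln f by rewrite ln_gt0.
pose w0 := ln f / ln gamma; have w00 : 0 < w0 by rewrite divr_gt0.
have neg w : 0 < w -> w <= w0 -> rate f w <= 0.
  move=> wp ww; rewrite /rate pmulr_lle0 ?invr_gt0// subr_le0 powR_expR.
  rewrite expRN ler_pdivlMr ?expR_gt0// mul1r -[leRHS]lnK ?posrE; last lra.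
  by rewrite ler_expR -ler_pdivlMr.
pose E := [set (1 - f * gamma `^ (- w)) / w | w in `]0, 1]].
have hs : has_sup E.
  split; last by apply: Sigma_has_ubound; exact: ltW.
  by exists (rate f 1); exists 1 => //=; rewrite in_itv/= ltr01 lexx.
have [r [w1 /=]] := sup_adherent S0 hs.
rewrite in_itv/= => /andP[w10 w11] <-; rewrite subrr => r1.
have w01 : w0 <= w1.
  by rewrite leNgt; apply/negP => /ltW h; have := neg _ w10 h; rewrite /rate; lra.
have cr : {within `[w0, 1], continuous (rate f)}.
  apply: continuous_in_subspaceT => w; rewrite inE/= in_itv/= => /andP[ww _].
  have wn : w != 0 by rewrite gt_eqF//; exact: lt_le_trans ww.
  have cg : {for w, continuous (fun w => gamma `^ (- w))}.
    have -> : (fun w => gamma `^ (- w)) = (fun w => expR (- (w * ln gamma))).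
      by apply/funext => z; exact: powR_expR.
    apply: continuous_comp; last exact: continuous_expR.
    by apply: cvgN; apply: cvgM; [exact: cvg_id|exact: cvg_cst].
  apply: cvgM; last exact: inv_continuous.
  by apply: cvgB; [exact: cvg_cst|apply: cvgM; [exact: cvg_cst|exact: cg]].
have [w wI wmax] := EVT_max (le_trans w01 w11) cr.
move: wI; rewrite in_itv/= => /andP[ww0 ww1].
have wp : 0 < w by exact: lt_le_trans ww0.
exists w; first by rewrite wp.
apply/eqP; rewrite eq_le; apply/andP; split; last first.
  by apply: Sigma_ge; [exact: ltW|rewrite wp].
apply: ge_sup; first by case: hs.
move=> y [z /=]; rewrite in_itv/= => /andP[z0 z1] <-.
have [zw|wz] := leP z w0.
  apply: (le_trans (neg _ z0 zw)).
  have : rate f w1 <= rate f w by apply: wmax; rewrite in_itv/= w01.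
  by apply: le_trans; rewrite /rate ltW.
by apply: wmax; rewrite in_itv/= z1 ltW.
Qed.

(** The margin is at least [a w], by the choice of [nu], and at least [b - c w], by [f0 > 1]. The
    first degenerates at [w = 0], so both are needed; [th] is their common value at the crossing
    [w = b / (a + c)]. Half of it is then spent on lowering [f0] to [f]. *)
Lemma speed_margin zeta f0 nu : 0 < zeta -> 1 < f0 -> 0 <= nu ->
  zeta * Sigma f0 gamma < nu ->
  exists f theta, [/\ 0 < f, f < f0, 0 < theta &
    forall w, 0 <= w <= 1 -> zeta - nu * w + theta <= zeta * f * gamma `^ (- w)].
Proof.
move=> z0 f1 nu0 cnu; have lg : 0 < ln gamma by rewrite ln_gt0.
pose a := nu - zeta * Sigma f0 gamma; pose b := zeta * (f0 - 1).
pose c := zeta * f0 * ln gamma.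
have a0 : 0 < a by rewrite subr_gt0.
have b0 : 0 < b by rewrite mulr_gt0// subr_gt0.
have c0 : 0 < c by rewrite !mulr_gt0//; lra.
pose th := a * b / (a + c).
have th0 : 0 < th by apply: divr_gt0; [exact: mulr_gt0|exact: addr_gt0].
have H w : 0 <= w <= 1 -> zeta - nu * w + th <= zeta * f0 * gamma `^ (- w).
  move=> /andP[w0 w1].
  have h1 : a * w <= zeta * f0 * gamma `^ (- w) - zeta + nu * w.
    move: w0; rewrite le_eqVlt => /predU1P[<-|w0].
      by rewrite !mulr0 oppr0 powRr0 mulr1 addr0 subr_ge0 ler_peMr ?ltW.
    have := @Sigma_ge f0 w (ltW f1); rewrite w0 w1 => /(_ erefl).
    rewrite /rate ler_pdivrMr// => h; have := ler_wpM2l (ltW z0) h.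
    by rewrite /a; lra.
  have h2 : b - c * w <= zeta * f0 * gamma `^ (- w) - zeta + nu * w.
    have /andP[h _] := powR_bounds w0.
    have zf : 0 <= zeta * f0 by rewrite mulr_ge0; lra.
    have := ler_wpM2l zf h; have := mulr_ge0 nu0 w0.
    by rewrite /b /c; lra.
  have ac : 0 < a + c by exact: addr_gt0.
  suff : th <= a * w \/ th <= b - c * w by case; lra.
  have [wb|bw] := leP (b / (a + c)) w.
    by left; rewrite /th -mulrA ler_wpM2l ?(ltW a0).
  right; have -> : th = b - c * (b / (a + c)) by rewrite /th; field; exact: lt0r_neq0.
  by rewrite lerD2l lerN2 ler_wpM2l// ltW.
pose f := f0 - th / (2 * zeta).
have fz : zeta * f = zeta * f0 - th / 2 by rewrite /f; field; exact: lt0r_neq0.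
have Hf w : 0 <= w <= 1 -> zeta - nu * w + th / 2 <= zeta * f * gamma `^ (- w).
  move=> w01; have := H _ w01; have /andP[w0 _] := w01.
  have /andP[_ h] := powR_bounds w0; have := powR_ge0 gamma (- w).
  by rewrite fz; nra.
exists f, (th / 2); split => //.
- have := Hf 0; rewrite lexx ler01 mulr0 subr0 oppr0 powRr0 mulr1 => /(_ erefl) h.
  by rewrite -(pmulr_rgt0 _ z0); lra.
- by rewrite /f ltrBlDr ltrDl divr_gt0// mulr_gt0.
- by rewrite divr_gt0.
Qed.

End sigma.

(** Subadditivity makes [y ^ w] Hölder with exponent [w], which covers the origin as well. *)
Lemma powR_within_continuous {R : realType} (C w : R) : 0 < w -> w <= 1 ->
  {within `[0, +oo[, continuous (fun y : R => C * y `^ w)}.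
Proof.
move=> w0 w1.
have H (a b : R) : 0 <= a -> a <= b -> b `^ w - a `^ w <= (b - a) `^ w.
  move=> a0 ab; rewrite lerBlDl; apply: le_trans (powR_subadditive w1 a0 _).
    by rewrite addrC subrK.
  by rewrite subr_ge0.
have holder (a b : R) : 0 <= a -> 0 <= b -> `|a `^ w - b `^ w| <= `|a - b| `^ w.
  move=> a0 b0; wlog ab : a b a0 b0 / b <= a.
    move=> W; have [ba|ab] := leP b a; first exact: W.
    by rewrite distrC (distrC a); apply: W => //; exact: ltW.
  rewrite !ger0_norm ?subr_ge0//; first exact: H.
  by apply: ge0_ler_powR; rewrite ?nnegrE// ltW.
apply/subspace_continuousP => x; rewrite /= in_itv/= andbT => x0.
apply: cvgM; first exact: cvg_cst.
apply/cvgrPdist_le => e e0; rewrite near_withinE; apply/nbhs_ballP.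
exists (e `^ w^-1); first by rewrite /= powR_gt0.
move=> y; rewrite /ball/= in_itv/= andbT => xy y0.
apply: (le_trans (holder _ _ x0 y0)).
have -> : e = (e `^ w^-1) `^ w by rewrite -powRrM mulVf ?gt_eqF// powRr1// ltW.
by apply: ge0_ler_powR; rewrite ?nnegrE ?powR_ge0// ltW.
Qed.

(** * The truncated nonlinearity and the constants [Upsilon] and [Xi] *)

Section clamped.
Context {R : realType} (f : R -> R) (L : R).
Hypothesis L0 : 0 < L.
Hypothesis f_odd : odd_on_unit f.
Hypothesis f_homo : forall v w, -1 <= v -> v <= w -> w <= 1 -> f v <= f w.
Hypothesis f_le1 : forall v, -1 <= v <= 1 -> f v <= 1.
Hypothesis f_lip : forall a b, 0 <= a -> a <= b -> b <= 1 -> f b - f a <= L * (b - a).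

Let g v := f (clamp v).

Let fN v : -1 <= v <= 1 -> f (- v) = - f v.
Proof. by move=> v1; apply: f_odd; rewrite in_itv. Qed.

Lemma odd_on_unit0 : f 0 = 0.
Proof. by have := @fN 0; rewrite oppr0 => h; have := h ltac:(lra); lra. Qed.

Lemma clamped_odd v : g (- v) = - g v.
Proof. by rewrite /g clampN fN// clamp_bounds. Qed.

Lemma clamped_homo : {homo g : a b / a <= b}.
Proof.
move=> a b ab; have /andP[a1 _] := clamp_bounds a; have /andP[_ b1] := clamp_bounds b.
by apply: f_homo => //; exact: le_clamp.
Qed.

Lemma clamped_le1 v : `|g v| <= 1.
Proof.
have vb := clamp_bounds v; rewrite ler_norml f_le1// andbT lerNl -fN//.
by apply: f_le1; lra.
Qed.

Lemma clamped_lipschitz a b c : 0 <= c -> a <= b + c -> g a <= g b + L * c.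
Proof.
move=> c0 abc; have := clamp_le_shift c0 abc; rewrite /g.
have := clamp_bounds a; have := clamp_bounds b.
move: (clamp a) (clamp b) => A B B1 A1 ABc; have Lc : 0 <= L * c by rewrite mulr_ge0// ltW.
have [AB|BA] := leP A B.
  by have := @f_homo A B ltac:(lra) AB ltac:(lra); lra.
suff : f A - f B <= L * (A - B).
  have : L * (A - B) <= L * c by rewrite ler_wpM2l//; [exact: ltW|lra].
  lra.
(* The Lipschitz bound is given on [[0, 1]] only: oddness transfers it to negative arguments, and an
   interval across 0 is split there. *)
have [B0|B0] := leP 0 B; first by apply: f_lip; lra.
have EB : f B = - f (- B) by rewrite fN; lra.
have [A0|A0] := leP A 0.
  have := @f_lip (- A) (- B) ltac:(lra) ltac:(lra) ltac:(lra).
  by have := @fN A ltac:(lra); rewrite EB; lra.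
have := @f_lip 0 A ltac:(lra) ltac:(lra) ltac:(lra).
have := @f_lip 0 (- B) ltac:(lra) ltac:(lra) ltac:(lra).
by rewrite odd_on_unit0 EB; lra.
Qed.

Lemma Upsilon_has_ubound : has_ubound [set f v / v | v in `]0, 1]].
Proof.
exists L; move=> r /= [v]; rewrite in_itv/= => /andP[v0 v1] <-.
rewrite ler_pdivrMr//.
by have := @f_lip 0 v ltac:(lra) ltac:(lra) v1; rewrite odd_on_unit0; lra.
Qed.

Lemma Upsilon_ge v : 0 <= v <= 1 -> f v <= Upsilon f * v.
Proof.
move=> /andP[+ v1]; rewrite le_eqVlt => /predU1P[<-|v0].
  by rewrite odd_on_unit0 mulr0.
rewrite -ler_pdivrMr//; apply: ub_le_sup; first exact: Upsilon_has_ubound.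
by exists v => //=; rewrite in_itv/= v0.
Qed.

Lemma Upsilon_gt l : is_derive_within `[0, 1] f 0 l -> 1 < l -> 1 < Upsilon f.
Proof.
move=> df l1; have [d /andP[d0 d1] Hd] :=
  @derivative_slope_lb _ _ _ ((1 + l) / 2) df odd_on_unit0 ltac:(lra).
have h1 := Hd d ltac:(lra); have h2 := @Upsilon_ge d ltac:(lra).
suff : (1 + l) / 2 <= Upsilon f by lra.
by rewrite -(ler_pM2r d0); lra.
Qed.

Lemma Xi_bounds : 0 <= Xi f <= 1.
Proof.
have h1 : [set v | v \in `]0, 1] /\ f v <= v] 1.
  by split; [rewrite in_itv/= ltr01 lexx|apply: f_le1; lra].
have lb : lbound [set v | v \in `]0, 1] /\ f v <= v] 0.
  by move=> v [+ _]; rewrite in_itv/= => /andP[/ltW].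
by apply/andP; split; [apply: lb_le_inf => //; exists 1|apply: ge_inf => //; exists 0].
Qed.

Lemma Xi_le S : 0 < S -> S <= 1 -> f S <= S -> Xi f <= S.
Proof.
move=> S0 S1 fS; apply: ge_inf; last by split => //; rewrite in_itv/= S0.
by exists 0 => v [+ _]; rewrite in_itv/= => /andP[/ltW].
Qed.

End clamped.

(** * Extension of [u] to negative times *)

Section past_extension.
Context {R : realType} (zeta gamma : R) (F : R -> R) (u : R -> R -> R).
Hypothesis u_mild : mild_solution gamma zeta F u.
Notation mu := (@lebesgue_measure R).

(** A mild solution is arbitrary at negative times; extending by zero gives bounds and joint
    measurability on the whole plane without changing the equation. *)
Definition zero_past t x : R := if 0 <= t then u t x else 0.

Lemma zero_past_le1 t x : `|zero_past t x| <= 1.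
Proof.
have [ub _ _] := u_mild; rewrite /zero_past; case: ifP => [t0|]; last by rewrite normr0.
by rewrite ler_norml ub.
Qed.

Lemma zero_past_jbm : jointly_bounded_measurable zero_past.
Proof.
have [_ mu_ _] := u_mild; split; last by exists 1; exact: zero_past_le1.
rewrite /zero_past; apply: measurable_fun_if => //.
- by apply: measurable_fun_ler => //; exact: measurable_fst.
- rewrite setTI; exact: mu_.
Qed.

Lemma zero_past_mild t x : 0 <= t ->
  zero_past t x = duhamel zeta gamma (fun v => F (clamp v)) zero_past t x.
Proof.
move=> t0; have [ub _ um] := u_mild; have -> : zero_past t x = u t x by rewrite /zero_past t0.
rewrite (um _ _ t0) /duhamel; congr (_ + _ * _).
apply: eq_Rintegral => s; rewrite inE/= in_itv/= => /andP[s0 _].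
congr killed_heat; apply/funext => y.
by rewrite /source /zero_past s0 clamp_id ?ub.
Qed.

End past_extension.

(** * Assembly of the upper and lower bounds *)

Section spreading_speed.
Context {R : realType} (zeta gamma : R) (z0 : 0 < zeta) (gamma1 : 1 < gamma).
Context (F : R -> R) (L : R) (L0 : 0 < L).
Hypothesis F_odd : forall v, F (- v) = - F v.
Hypothesis F_homo : {homo F : a b / a <= b}.
Hypothesis F_lip : forall a b c, 0 <= c -> a <= b + c -> F a <= F b + L * c.
Hypothesis F_le1 : forall v, `|F v| <= 1.
Context (u : R -> R -> R).
Hypothesis u_jbm : jointly_bounded_measurable u.
Hypothesis u_le1 : forall t x, `|u t x| <= 1.
Hypothesis u_mild : forall t x, 0 <= t -> u t x = duhamel zeta gamma F u t x.

Lemma mild_upper_bound Y : 1 < Y -> (forall v, 0 <= v <= 1 -> F v <= Y * v) ->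
  0 < Sigma Y gamma ->
  exists v : R -> R, [/\ {within `[0, +oo[, continuous v}, v 0 = 0 &
    forall t x, 1 <= t -> 0 <= x ->
      u t x <= v (x * expR (- (zeta * Sigma Y gamma * t)))].
Proof.
move=> Y1 FY S0; have Y0 : 0 < Y by lra.
have [w /andP[w0 w1] Sw] := Sigma_attained gamma1 Y1 S0.
exists (fun y => (2 + 24 * kappa zeta gamma Y w) * y `^ w); split.
- exact: powR_within_continuous.
- by rewrite powR0 ?mulr0// gt_eqF.
move=> t x t1 x0; have t0 : 0 < t by lra.
have := supersolution_ge z0 gamma1 L0 F_odd F_homo F_lip F_le1 u_jbm u_le1 u_mild
  Y0 FY (barrier_jbm zeta gamma Y w) (fun s y _ => barrier_odd zeta gamma Y w s y)
  (fun s y _ y0 => barrier_ge0 z0 gamma1 Y0 w0 s y0)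
  (barrier_super z0 gamma1 Y0 w0 w1) t0 x0.
move=> /le_trans; apply.
have xw : 0 <= x `^ w by exact: powR_ge0.
have c0 := barrier_coef_ge0 w z0 gamma1 Y0 t.
rewrite /barrier (spowE w0 x0).
have /andP[_] := clamp_le (mulr_ge0 c0 xw); move=> /le_trans; apply.
have := ler_wpM2r xw (barrier_coef_ge1 w z0 gamma1 Y0 t1); move=> /le_trans; apply.
rewrite powRM ?expR_ge0// -[leLHS]mulrA ler_wpM2l//.
  by have := kappa_gt0 w z0 gamma1 Y0; lra.
rewrite mulrC ler_wpM2l// -expRM ler_expR Sw /kappa le_eqVlt.
by apply/orP; left; apply/eqP; field; exact: lt0r_neq0.
Qed.

Lemma mild_lower_bound nu f theta d X : 0 <= nu -> 0 < f -> 0 < theta ->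
  (forall w, 0 <= w <= 1 -> zeta - nu * w + theta <= zeta * f * gamma `^ (- w)) ->
  0 < d -> (forall v, 0 <= v <= d -> f * v <= F v) ->
  0 <= X <= 1 -> (forall S, 0 < S -> S <= 1 -> F S <= S -> X <= S) ->
  exists v : R -> R, [/\ {within `[0, +oo[, continuous v}, v x @[x --> +oo] --> X &
    forall t x, 0 <= t -> 0 <= x -> v (x * expR (- (nu * t))) <= u t x].
Proof.
move=> nu0 f0 theta0 speed d0 Ff X01 XS.
have u_ge0 := mild_ge0 z0 gamma1 L0 F_odd F_homo F_lip F_le1 u_jbm u_le1 u_mild.
have u_odd t x : 0 <= t -> u t (- x) = - u t x.
  exact: (mild_odd z0 L0 F_odd F_homo F_lip F_le1 u_jbm u_le1 u_mild).
have [e [K [e0 K0 eK]]] := lower_barrier_pos z0 gamma1 nu0 f0 theta0 d0.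
have b1 := lower_barrier_le1 z0 gamma1 nu0 f0 theta0 d0.
have ev : eventually_ge nu u e.
  exists K => // t x t0 Kx; apply: (le_trans (eK _ _ Kx)).
  have x0 : 0 < x by apply: lt_le_trans Kx; rewrite mulr_gt0// expR_gt0.
  move: t0; rewrite le_eqVlt => /predU1P[<-|t0].
    by rewrite (mild0 u_mild) gtr0_sg.
  apply: (subsolution_le z0 gamma1 L0 F_odd F_homo F_lip F_le1 u_jbm u_le1 u_mild
    (lower_barrier_jbm z0 gamma1 nu0 f0 theta0 d0)) => //; last exact: ltW.
  - by move=> *; exact: lower_barrier_odd.
  - by move=> *; exact: lower_barrier_sub.
have [S [S0 S1 FS evS]] := eventually_ge_fixed z0 gamma1 nu0 L0 F_odd F_homo F_lip
  F_le1 u_jbm u_le1 u_odd u_ge0 u_mild e0 ev.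
apply: (lipschitz_minorant u_ge0) => // e' e'0.
have [Y Y0 HY] := evS _ e'0; exists Y => // t x t0 Yx.
by apply: le_trans (HY _ _ t0 Yx); rewrite lerD2r XS.
Qed.

End spreading_speed.

Unset Implicit Arguments.

Theorem theorem1p9 (R : realType) (gamma zeta : R)
    (p : nat -> R) (eta : nat -> nat -> R) (u : R -> R -> R)
    (F := voting_fun p eta)
    (c_low := zeta * Sigma (Upsilon F) gamma)
    (c_up := zeta * Sigma (derive1 F 0) gamma) :
  1 < gamma -> 0 < zeta ->
  is_offspring_law p -> is_threshold_law eta ->
  C2_on `[0, 1] F -> odd_on_unit F -> 1 < derive1 F 0 ->
  mild_solution gamma zeta F u ->
  (0 < Sigma (Upsilon F) gamma ->
     exists vbar : R -> R,
       [/\ {within `[0, +oo[, continuous vbar},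
           vbar 0 = 0
         & forall t x, 1 <= t -> 0 <= x ->
             u t x <= vbar (x * expR (- (c_low * t)))]) /\
  (forall nu : R, 0 <= nu -> c_up < nu ->
     exists vund : R -> R,
       [/\ {within `[0, +oo[, continuous vund},
           vund x @[x --> +oo] --> Xi F
         & forall t x, 0 <= t -> 0 <= x ->
             vund (x * expR (- (nu * t))) <= u t x]).
Proof.
move=> gamma1 z0 pP etaP C2F F_odd; have [L L0 F_lip] := C2_lipschitz C2F.
have [f1 [f2 [df1 _ _]]] := C2F.
have dF0 : is_derive_within `[0, 1] F 0 (f1 0).
  by apply: df1; rewrite /= in_itv/= lexx ler01.
rewrite /c_up (odd_derive1_0 F_odd dF0) => l1 u_mild.
have F_homo := voting_fun_homo pP etaP; have F_le1 := voting_fun_le1 pP etaP.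
have F00 := odd_on_unit0 F_odd.
have clF v : 0 <= v <= 1 -> F (clamp v) = F v by move=> v01; rewrite clamp_id//; lra.
have oF := clamped_odd F_odd.
have hF := clamped_homo F_homo.
have lF := clamped_lipschitz L0 F_odd F_homo F_lip.
have bF := clamped_le1 F_odd F_le1.
have uE t x : 0 <= t -> u t x = zero_past u t x by rewrite /zero_past => ->.
split=> [S0|nu nu0 cnu].
- have FY v : 0 <= v <= 1 -> F (clamp v) <= Upsilon F * v.
    by move=> v01; rewrite clF//; exact: Upsilon_ge F_odd F_lip _ v01.
  have [v [cv v0 Hv]] := mild_upper_bound z0 gamma1 L0 oF hF lF bF (zero_past_jbm u_mild)
    (zero_past_le1 u_mild) (zero_past_mild u_mild) (Upsilon_gt F_odd F_lip dF0 l1) FY S0.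
  by exists v; split => // t x t1 x0; rewrite uE ?Hv//; lra.
- have [f [theta [f0 fl th0 speed]]] := speed_margin gamma1 z0 l1 nu0 cnu.
  have [d /andP[d0 d1] Fd] := derivative_slope_lb dF0 F00 fl.
  have {}Fd v : 0 <= v <= d -> f * v <= F (clamp v).
    by move=> vd; rewrite clF; [exact: Fd|lra].
  have XS S : 0 < S -> S <= 1 -> F (clamp S) <= S -> Xi F <= S.
    by move=> S0 S1; rewrite clF; [exact: Xi_le|lra].
  have [v [cv v0 Hv]] := mild_lower_bound z0 gamma1 L0 oF hF lF bF (zero_past_jbm u_mild)
    (zero_past_le1 u_mild) (zero_past_mild u_mild) nu0 f0 th0 speed d0 Fd
    (Xi_bounds F_le1) XS.
  by exists v; split => // t x t0 x0; rewrite uE ?Hv.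
Qed.
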